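(* The Lorentzian inner product $$q=\omega_1^2+\omega_2^2+\omega_3^2-\alpha_1^2+\beta_1^2+\beta_2^2+\beta_3^2+\gamma_1^2+\gamma_2^2+\gamma_3^2$$ on $so(5)$ induces a structure of Lorentzian $(\mathbb{Z}_2\times\mathbb{Z}_2)$-symmetric space on the nonsymmetric homogeneous space $SO(5)/SO(3)$.
   Context: Write a general element of $so(5)$ as $$\begin{pmatrix}0&a_1&b_1&b_2&b_3\\-a_1&0&c_1&c_2&c_3\\-b_1&-c_1&0&x_1&x_2\\-b_2&-c_2&-x_1&0&x_3\\-b_3&-c_3&-x_2&-x_3&0\end{pmatrix},$$ with real coordinates. Let $\mathfrak{g}_e,\mathfrak{g}_a,\mathfrak{g}_b,\mathfrak{g}_c$ be the subspaces parametrized respectively by $(x_1,x_2,x_3)$, by $a_1$, by $(b_1,b_2,b_3)$ and by $(c_1,c_2,c_3)$ (all other coordinates zero). With $\mathbb{Z}_2\times\mathbb{Z}_2=\{e,a,b,c\}$ this is a $(\mathbb{Z}_2\times\mathbb{Z}_2)$-grading of $so(5)$ with $\mathfrak{g}_e\cong so(3)$, which defines the $(\mathbb{Z}_2\times\mathbb{Z}_2)$-symmetric space $SO(5)/(SO(3)\times SO(1)\times SO(1))=SO(5)/SO(3)$, $SO(3)$ being embedded in the lower right $3\times3$ block. The dual basis of the corresponding graded basis $\{X_1,X_2,X_3,A_1,B_1,B_2,B_3,C_1,C_2,C_3\}$ (each capital letter is the matrix with the corresponding small-letter coordinate equal to $1$ and the others $0$) is $\{\omega_i,\alpha_1,\beta_i,\gamma_i\}$.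 $\Gamma$-symmetric space: for $\Gamma$ a finite abelian group, a triple $(G,H,\Gamma_G)$ with $G$ a connected Lie group, $H$ a closed subgroup, and $\Gamma_G$ a subgroup of $\mathrm{Aut}(G)$ isomorphic to $\Gamma$ such that $H$ lies between the subgroup of elements fixed by $\Gamma_G$ and its identity component, $H$ containing no proper normal subgroup of $G$. The symmetric case is $\Gamma=\mathbb{Z}_2$. It gives a $\Gamma$-grading $\mathfrak{g}=\bigoplus\mathfrak{g}_\gamma$ of the Lie algebra of $G$ by simultaneous eigenspaces, with $\mathfrak{g}_e$ the Lie algebra of $H$; put $\mathfrak{m}=\bigoplus_{\gamma\neq e}\mathfrak{g}_\gamma\cong T_{\bar e}(G/H)$. Lorentzian $\Gamma$-symmetric space: a $\Gamma$-symmetric space $(G,H,\Gamma_G)$ together with a $G$-invariant semi-Riemannian metric $g$ on $M=G/H$ of signature $(1,n-1)$, $n=\dim M$ (here: one negative direction), such that for the corresponding $\mathrm{ad}\,\mathfrak{g}_e$-invariant symmetric bilinear form $B$ on $\mathfrak{m}$ the homogeneous components of $\mathfrak{m}$ are pairwise orthogonal. Here $g$ is the metric corresponding to the restriction of $q$ to $\mathfrak{m}=\mathfrak{g}_a\oplus\mathfrak{g}_b\oplus\mathfrak{g}_c$. *)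

(* Defs.v *)
From HB Require Import structures.
From mathcomp Require Import all_boot all_order all_algebra.
From mathcomp Require Import all_classical all_reals all_analysis.
Import Order.TTheory GRing.Theory Num.Theory.
Import numFieldNormedType.Exports.

Set Implicit Arguments.
Unset Strict Implicit.
Unset Printing Implicit Defensive.

Local Open Scope classical_set_scope.
Local Open Scope ring_scope.

(* The join of two existing structures on a product, which the library does not
   declare. *)
HB.instance Definition _ (A B : finZmodType) := Finite.on (A * B)%type.

Section Smooth.
Context {R : realType} {U V : normedModType R}.

(* For an open set O of a finite-dimensional U this is the class C^k on O: all
   iterated directional derivatives of order at most k exist and are
   continuous on O. *)
Fixpoint class_C (k : nat) (O : set U) (f : U -> V) : Prop :=
  (forall x, O x -> {for x, continuous f}) /\
  (if k is k'.+1 then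
     forall v : U, (forall x, O x -> derivable f x v) /\
                   class_C k' O (fun x => 'D_v f x)
   else True).

(* Smoothness on a submanifold G of U: near each of its points, f is the
   restriction to G of a C^oo map defined on an open subset of U. *)
Definition smooth_on (G : set U) (f : U -> V) : Prop :=
  forall x, G x -> exists (O : set U) (F : U -> V),
    [/\ open O, O x, forall k, class_C k O F
      & forall y, O y -> G y -> F y = f y].

End Smooth.

Section LinearLieGroups.
Context {R : realType} {n : nat}.
Local Notation M := 'M[R]_n.+1.
Implicit Types (G H N : set M) (g h X Y : M).

Definition subgroup_GL G : Prop :=
  [/\ G 1%:M,
      forall g h, G g -> G h -> G (g *m h)
    & forall g, G g -> g \in unitmx /\ G (invmx g)].

(* Closed in GL_n(R), not necessarily in the space of all matrices. *)
Definition linear_lie_group G : Prop :=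
  subgroup_GL G /\ closure G `&` [set g | g \in unitmx] `<=` G.

Definition closed_subgroup G H : Prop :=
  [/\ subgroup_GL H, H `<=` G & closure H `&` G `<=` H].

Definition normal_subgroup G N : Prop :=
  [/\ subgroup_GL N, N `<=` G
    & forall g x, G g -> N x -> N (g *m x *m invmx g)].

(* Only the values of s on G are meaningful here. *)
Definition lie_hom G (s : M -> M) : Prop :=
  [/\ forall g, G g -> G (s g),
      forall g h, G g -> G h -> s (g *m h) = s g *m s h
    & smooth_on G s].

Definition lie_aut G (s : M -> M) : Prop :=
  lie_hom G s /\
  exists t, [/\ lie_hom G t, forall g, G g -> t (s g) = g
              & forall g, G g -> s (t g) = g].

Definition curve_through G g (c : R -> M) X : Prop :=
  [/\ forall t, G (c t), c 0 = g & is_derive (0 : R) 1 c X].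

(* Tangent vectors at g of the submanifold G are matrices; tangent G 1%:M is the
   Lie algebra of G. *)
Definition tangent G g : set M := [set X | exists c, curve_through G g c X].

Definition tangent_map G (s : M -> M) X Y : Prop :=
  forall c, curve_through G 1%:M c X -> is_derive (0 : R) 1 (s \o c) Y.

End LinearLieGroups.

Section GammaSymmetric.
Context {R : realType} {n : nat}.
Local Notation M := 'M[R]_n.+1.
Implicit Types (G H N : set M) (g h u v w X Y : M).

(* A finite abelian group Gamma is written additively, with neutral element 0.
   The map rho is an isomorphism of Gamma onto a subgroup Gamma_G of Aut(G). *)
Definition faithful_action (Gamma : finZmodType) G (rho : Gamma -> M -> M) :
    Prop :=
  [/\ forall a, lie_aut G (rho a),
      forall a b g, G g -> rho (a + b) g = rho a (rho b g)
    & forall a, (forall g, G g -> rho a g = g) -> a = 0].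

Definition fixed_points (Gamma : finZmodType) G (rho : Gamma -> M -> M) :
    set M :=
  [set g | G g /\ forall a, rho a g = g].

Definition gamma_symmetric (Gamma : finZmodType) G H (rho : Gamma -> M -> M) :
    Prop :=
  [/\ linear_lie_group G /\ connected G,
      closed_subgroup G H,
      faithful_action G rho,
      connected_component (fixed_points G rho) 1%:M `<=` H /\
        H `<=` fixed_points G rho
    & forall N, normal_subgroup G N -> N `<=` H -> N = [set 1%:M]].

Definition simultaneous_eigenspace (Gamma : finZmodType) G
    (rho : Gamma -> M -> M) (chi : Gamma -> R) : set M :=
  [set X | tangent G 1%:M X /\
           forall a, tangent_map G (rho a) X (chi a *: X)].

(* chi identifies Gamma with its group of characters, as is implicit in
   labelling the simultaneous eigenspaces by elements of Gamma. Characters are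
   real-valued, so this covers the groups Gamma of exponent 2, the ones for which
   the eigenspaces decompose the real Lie algebra. *)
Definition gamma_grading (Gamma : finZmodType) G H (rho : Gamma -> M -> M)
    (gr : Gamma -> set M) : Prop :=
  [/\ exists chi : Gamma -> Gamma -> R,
        [/\ forall a b b', chi a (b + b') = chi a b * chi a b',
            forall a a' b, chi (a + a') b = chi a b * chi a' b,
            injective chi, forall b, chi 0 b = 1
          & forall a, gr a = simultaneous_eigenspace G rho (chi a)],
      forall X, tangent G 1%:M X ->
        exists! f : {ffun Gamma -> M},
          (forall a, gr a (f a)) /\ X = \sum_a f a,
      forall a b X Y, gr a X -> gr b Y -> gr (a + b) (X *m Y - Y *m X)
    & gr 0 = tangent H 1%:M].

(* The sum of the components other than gr 0, a model of the tangent space of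
   G/H at the base point. *)
Definition complement_m (Gamma : finZmodType) (gr : Gamma -> set M) : set M :=
  [set X | exists f : Gamma -> M,
     (forall a, a != 0 -> gr a (f a)) /\ X = \sum_(a | a != 0) f a].

(* The form induced by B on the quotient V/W has signature (1, d - 1), where
   d = \dim (V/W) >= 1: the e_i represent a basis of V/W that is orthonormal up to
   the sign of the first vector. *)
Definition lorentz_signature (V W : set M) (B : M -> M -> R) : Prop :=
  exists (d : nat) (e : 'I_d.+1 -> M),
    [/\ forall i, V (e i),
        forall u, V u -> exists! c : 'rV[R]_d.+1, W (u - \sum_i c 0 i *: e i)
      & forall i j, B (e i) (e j) =
          if i == j then (if i == ord0 then -1 else 1) else 0].

Definition symmetric_bilinear_on (V : set M) (B : M -> M -> R) : Prop :=
  (forall u v, V u -> V v -> B u v = B v u) /\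
  (forall (k : R) u v w, V u -> V v -> V w ->
     B (k *: u + v) w = k * B u w + B v w).

Definition lcoset_of H g : set M := [set g *m h | h in H].

(* A G-invariant Lorentzian metric on G/H, given by its pullback gm to G under the
   submersion p : G -> G/H, i.e.
     gm g u v = metric_(gH) (dp_g u) (dp_g v)   for u, v tangent to G at g.
   Since T_gH(G/H) is the quotient of T_g G by ker dp_g = T_g(gH), pulling back is
   a bijection from the metrics on G/H onto the smooth symmetric tensors on G that
   vanish on T_g(gH), are invariant under right translations by H, and induce a
   nondegenerate form on each quotient. Smoothness is tested on the frame of
   left-invariant vector fields. *)
Definition invariant_lorentz_metric G H (gm : M -> M -> M -> R) : Prop :=
  [/\ forall g, G g -> symmetric_bilinear_on (tangent G g) (gm g),
      (forall X Y, tangent G 1%:M X -> tangent G 1%:M Y ->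
         smooth_on G (fun g => gm g (g *m X) (g *m Y) : R^o)),
      (forall g u v, G g -> tangent (lcoset_of H g) g u -> tangent G g v ->
         gm g u v = 0) /\
      (forall g h u v, G g -> H h -> tangent G g u -> tangent G g v ->
         gm (g *m h) (u *m h) (v *m h) = gm g u v),
      forall g, G g ->
         lorentz_signature (tangent G g) (tangent (lcoset_of H g) g) (gm g)
    & forall k g u v, G k -> G g -> tangent G g u -> tangent G g v ->
         gm (k *m g) (k *m u) (k *m v) = gm g u v].

(* The bilinear form on complement_m gr corresponding to the metric is gm 1%:M. *)
Definition lorentzian_gamma_symmetric (Gamma : finZmodType) G H
    (rho : Gamma -> M -> M) (gr : Gamma -> set M) (gm : M -> M -> M -> R) :
    Prop :=
  [/\ gamma_symmetric G H rho,
      gamma_grading G H rho gr,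
      invariant_lorentz_metric G H gm
    & forall a b X Y, a != 0 -> b != 0 -> a != b -> gr a X -> gr b Y ->
        gm 1%:M X Y = 0].

End GammaSymmetric.

Section SO5.
Context (R : realType).

Definition SO (n : nat) : set 'M[R]_n :=
  [set A | A *m A^T = 1%:M /\ \det A = 1].
Arguments SO : clear implicits.

Definition SO3_in_SO5 : set 'M[R]_5 :=
  [set (block_mx 1%:M 0 0 A : 'M[R]_(2 + 3)) | A in SO 3].

Definition so5_mx (a1 b1 b2 b3 c1 c2 c3 x1 x2 x3 : R) : 'M[R]_5 :=
  \matrix_(i < 5, j < 5) nth 0 (nth [::]
    [:: [::   0;  a1;  b1;  b2; b3];
        [:: -a1;   0;  c1;  c2; c3];
        [:: -b1; -c1;   0;  x1; x2];
        [:: -b2; -c2; -x1;   0; x3];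
        [:: -b3; -c3; -x2; -x3;  0]] i) j.

Definition so5_e : set 'M[R]_5 :=
  [set X | exists x1 x2 x3, X = so5_mx 0 0 0 0 0 0 0 x1 x2 x3].
Definition so5_a : set 'M[R]_5 :=
  [set X | exists a1, X = so5_mx a1 0 0 0 0 0 0 0 0 0].
Definition so5_b : set 'M[R]_5 :=
  [set X | exists b1 b2 b3, X = so5_mx 0 b1 b2 b3 0 0 0 0 0 0].
Definition so5_c : set 'M[R]_5 :=
  [set X | exists c1 c2 c3, X = so5_mx 0 0 0 0 c1 c2 c3 0 0 0].

(* Z_2 x Z_2 = {e, a, b, c} with e = (0,0), a = (1,0), b = (0,1), c = (1,1). *)
Definition so5_component (k : 'Z_2 * 'Z_2) : set 'M[R]_5 :=
  if k == (0, 0) then so5_e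
  else if k == (1, 0) then so5_a
  else if k == (0, 1) then so5_b
  else so5_c.

(* Row and column indices start at 0: the coordinate forms on so(5) dual to the
   basis X_i, A_1, B_i, C_i are entries above the diagonal. *)
Definition omega1 (X : 'M[R]_5) : R := X (inord 2) (inord 3).
Definition omega2 (X : 'M[R]_5) : R := X (inord 2) (inord 4).
Definition omega3 (X : 'M[R]_5) : R := X (inord 3) (inord 4).
Definition alpha1 (X : 'M[R]_5) : R := X (inord 0) (inord 1).
Definition beta1 (X : 'M[R]_5) : R := X (inord 0) (inord 2).
Definition beta2 (X : 'M[R]_5) : R := X (inord 0) (inord 3).
Definition beta3 (X : 'M[R]_5) : R := X (inord 0) (inord 4).
Definition gamma1 (X : 'M[R]_5) : R := X (inord 1) (inord 2).
Definition gamma2 (X : 'M[R]_5) : R := X (inord 1) (inord 3).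
Definition gamma3 (X : 'M[R]_5) : R := X (inord 1) (inord 4).

(* The square of a linear form stands for its tensor square. *)
Definition q5 (X Y : 'M[R]_5) : R :=
  omega1 X * omega1 Y + omega2 X * omega2 Y + omega3 X * omega3 Y
  - alpha1 X * alpha1 Y
  + beta1 X * beta1 Y + beta2 X * beta2 Y + beta3 X * beta3 Y
  + gamma1 X * gamma1 Y + gamma2 X * gamma2 Y + gamma3 X * gamma3 Y.

End SO5.

Arguments SO : clear implicits.

(* Main.v *)
From HB Require Import structures.
Require Import Defs.
From mathcomp Require Import all_boot all_order all_algebra perm.
From mathcomp Require Import all_classical all_reals all_analysis.
From mathcomp Require Import ring lra.
Import Order.TTheory GRing.Theory Num.Theory.
Import numFieldNormedType.Exports.

Set Implicit Arguments.
Unset Strict Implicit.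
Unset Printing Implicit Defensive.

Local Open Scope classical_set_scope.
Local Open Scope ring_scope.

(* SO(n) is connected because every A in SO(n) can be written D O, where D is a
   diagonal sign matrix with det (D + A) <> 0 and O is the Cayley transform of a
   skew matrix; D is a product of rotations by pi in coordinate planes.

   The grading is the eigenspace decomposition of conjugation by the diagonal
   matrices diag(chi_b, chi_c, 1, 1, 1), where chi_b, chi_c are the characters
   labelled b and c. The metric is the left-invariant extension of the form q with
   the omega_i^2 removed.

   SO(5)/SO(3) is not symmetric: let s be an involutive automorphism fixing
   H = SO(3), such that connected sets of fixed points through 1 lie in H. For a
   curve c through 1 commuting with s c, the curve c (s c) is fixed, hence lies in
   H. The centralizer of H is the group O(2) of the first two coordinates, and
   this shows that s inverts the rotations of the plane (0, 1). After conjugation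
   by such a rotation, s also fixes the reflection w0 of that O(2). Then s inverts
   the rotations of the plane (0, 2), by the same argument applied to the
   centralizer of w0 and of the rotations of the plane (3, 4). It follows that s
   fixes their conjugates by the quarter turn in the plane (0, 1), which do not
   lie in H. *)

(** * Calculus with matrix-valued maps *)

Section MatrixCalculus.
Context {R : realType}.

Lemma is_derive_mxP {m n} (M : R -> 'M[R]_(m, n)) (t : R) (dM : 'M[R]_(m, n)) :
  is_derive t (1 : R) M dM <-> forall i j, is_derive t (1 : R) (fun x => M x i j) (dM i j).
Proof.
split=> [[dM1 dM2] i j|H].
  have/derivable_mxP h := dM1; split; first exact: h.
  by rewrite -dM2 derive_mx// mxE.
have h : derivable M t 1 by apply/derivable_mxP => i j; have [] := H i j.
split=> //; rewrite derive_mx//; apply/matrixP => i j; rewrite mxE.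
by have [] := H i j.
Qed.

Lemma is_derive_mulmx {m n p} (A : R -> 'M[R]_(m, n)) (B : R -> 'M[R]_(n, p))
    (t : R) (dA : 'M[R]_(m, n)) (dB : 'M[R]_(n, p)) :
  is_derive t (1 : R) A dA -> is_derive t (1 : R) B dB ->
  is_derive t (1 : R) (fun x => A x *m B x) (dA *m B t + A t *m dB).
Proof.
move=> /is_derive_mxP hA /is_derive_mxP hB; apply/is_derive_mxP => i j.
rewrite (_ : (fun x => _) = \sum_k ((fun x => A x i k) * (fun x => B x k j))).
  rewrite (_ : fun_of_matrix _ i j = \sum_k (A t i k *: dB k j + B t k j *: dA i k)).
    by apply: is_derive_sum => k; apply: is_deriveM.
  rewrite !mxE -big_split/=; apply: eq_bigr => k _.
  by rewrite addrC [_ *: dA i k]mulrC.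
by apply/funext => x; rewrite mxE fct_sumE.
Qed.

Lemma is_derive_trmx {m n} (A : R -> 'M[R]_(m, n)) (t : R) (dA : 'M[R]_(m, n)) :
  is_derive t (1 : R) A dA -> is_derive t (1 : R) (fun x => (A x)^T) dA^T.
Proof.
move=> /is_derive_mxP h; apply/is_derive_mxP => i j; rewrite mxE.
by rewrite (_ : (fun x => _) = fun x => A x j i)//; apply/funext => x; rewrite mxE.
Qed.

Context {T : topologicalType}.

Lemma continuous_mxP {m n} (f : T -> 'M[R]_(m, n)) x :
  {for x, continuous f} <-> forall i j, {for x, continuous (fun y => f y i j)}.
Proof.
split=> [h i j|h].
  apply: (@continuous_comp _ _ _ f (fun M : 'M[R]_(m, n) => M i j)) => //.
  exact: coord_continuous.
move=> A [P nP sPA]; rewrite nbhs_simpl/=.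
(* A basic neighbourhood of a matrix is a family of neighbourhoods of its finitely many entries. *)
have hP : \forall y \near x, forall ij : 'I_m * 'I_n, P ij.1 ij.2 (f y ij.1 ij.2).
  by apply: filter_forall => -[i j] /=; apply: (h i j); exact: nP.
by apply: filterS hP => y Py; apply: sPA => i j; exact: (Py (i, j)).
Qed.

(** Entries of matrix products and determinants are both sums of products of entries; this is their
    common continuity statement. *)
Lemma continuous_sum_prod (I : finType) (J : Type) (r : J -> seq I)
  (S : seq J) (F : J -> I -> T -> R) x :
  (forall i j, {for x, continuous (F j i)}) ->
  {for x, continuous (fun y => \sum_(j <- S) \prod_(i <- r j) F j i y)}.
Proof.
move=> h; elim: S => [|j S IH].
  by under [X in {for _, continuous X}]funext do rewrite big_nil; exact: cvg_cst.
under [X in {for _, continuous X}]funext do rewrite big_cons.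
apply: continuousD => //; elim: (r j) => [|i s IHs].
  by under [X in {for _, continuous X}]funext do rewrite big_nil; exact: cvg_cst.
by under [X in {for _, continuous X}]funext do rewrite big_cons; exact: continuousM.
Qed.

Lemma continuous_mulmx {m n p} (A : T -> 'M[R]_(m, n)) (B : T -> 'M[R]_(n, p)) x :
  {for x, continuous A} -> {for x, continuous B} ->
  {for x, continuous (fun y => A y *m B y)}.
Proof.
move=> /continuous_mxP hA /continuous_mxP hB; apply/continuous_mxP => i j.
under [X in {for _, continuous X}]funext do rewrite mxE.
(* The two factors of each term are indexed by the list [[:: true; false]]. *)
have := @continuous_sum_prod bool 'I_n (fun=> [:: true; false]) (index_enum 'I_n)
  (fun k b y => if b then A y i k else B y k j) x.
under [X in _ -> {for _, continuous X}]funext do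
  under eq_bigr do rewrite big_cons big_seq1.
by apply=> -[] k; [exact: hA|exact: hB].
Qed.

Lemma continuous_trmx {m n} (A : T -> 'M[R]_(m, n)) x :
  {for x, continuous A} -> {for x, continuous (fun y => (A y)^T)}.
Proof.
move=> /continuous_mxP hA; apply/continuous_mxP => i j.
under [X in {for _, continuous X}]funext do rewrite mxE.
exact: hA.
Qed.

Lemma continuous_det {n} (A : T -> 'M[R]_n) x :
  {for x, continuous A} -> {for x, continuous (fun y => \det (A y))}.
Proof.
move=> /continuous_mxP hA; rewrite /determinant.
(* The signature becomes the factor at [None], so that each term is a single product. *)
have E (s : {perm 'I_n}) y : (-1) ^+ s * \prod_i A y i (s i) =
  \prod_(o : option 'I_n) (if o is Some i then A y i (s i) else (-1) ^+ s).
  rewrite [RHS](bigD1 None)//=; congr (_ * _).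
  rewrite [RHS](reindex_omap Some id)//=; last by case.
  by apply: eq_bigl => i; rewrite eqxx.
under [X in {for _, continuous X}]funext do under eq_bigr do rewrite E.
apply: (@continuous_sum_prod _ _ _ _ (fun (s : {perm 'I_n}) o y =>
  if o is Some i then A y i (s i) else (-1) ^+ s)).
by move=> -[i|] s; [exact: hA|exact: cvg_cst].
Qed.

(** Cramer's rule. [invmx] returns its argument on singular matrices, hence invertibility is assumed
    at every [y]. *)
Lemma continuous_invmx {n} (A : T -> 'M[R]_n) x :
  (forall y, A y \in unitmx) -> {for x, continuous A} ->
  {for x, continuous (fun y => invmx (A y))}.
Proof.
move=> uA cA; apply/continuous_mxP => i j.
have E y : invmx (A y) i j =
   (\det (A y))^-1 * ((-1) ^+ (j + i) * \det (row' j (col' i (A y)))).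
  by rewrite /invmx uA !mxE.
under [X in {for _, continuous X}]funext do rewrite E.
apply: (@continuousM _ _ (fun y => (\det (A y))^-1)
  (fun y => (-1) ^+ (j + i) * \det (row' j (col' i (A y))))).
  apply: continuousV; last exact: continuous_det.
  by have := uA x; rewrite unitmxE unitfE.
apply: (@continuousM _ _ (fun=> (-1) ^+ (j + i))
  (fun y => \det (row' j (col' i (A y))))); first exact: cvg_cst.
apply: continuous_det; apply/continuous_mxP => k l.
under [X in {for _, continuous X}]funext do rewrite !mxE.
exact: (continuous_mxP _ _).1.
Qed.

End MatrixCalculus.

(** * The special orthogonal group *)

Definition skew_delta {R : realType} {n : nat} (i j : 'I_n.+1) : 'M[R]_n.+1 :=
  delta_mx i j - delta_mx j i.

(* Locked because unification would otherwise compare rotations by unfolding them. *)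
HB.lock Definition rotation {R : realType} {n : nat} (i j : 'I_n.+1) (t : R) :
    'M[R]_n.+1 :=
  1 + sin t *: skew_delta i j + (1 - cos t) *: (skew_delta i j * skew_delta i j).

Section SpecialOrthogonal.
Context {R : realType}.

Lemma SO_trmul {n} (A : 'M[R]_n) : SO R n A -> A^T *m A = 1%:M.
Proof. by move=> [/mulmx1C]. Qed.

Lemma SO1 {n} : SO R n 1%:M.
Proof. by split; rewrite ?trmx1 ?mulmx1 ?det1. Qed.

Lemma SO_mul {n} (A B : 'M[R]_n) : SO R n A -> SO R n B -> SO R n (A *m B).
Proof.
move=> [oA dA] [oB dB]; split; last by rewrite det_mulmx dA dB mulr1.
by rewrite trmx_mul mulmxA -(mulmxA A) oB mulmx1.
Qed.

Lemma SO_tr {n} (A : 'M[R]_n) : SO R n A -> SO R n A^T.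
Proof.
by move=> hA; split; [rewrite trmxK SO_trmul|rewrite det_tr; case: hA].
Qed.

Lemma SO_unit {n} (A : 'M[R]_n) : SO R n A -> A \in unitmx.
Proof. by move=> [_ dA]; rewrite unitmxE dA unitr1. Qed.

Lemma SO_inv {n} (A : 'M[R]_n) : SO R n A -> invmx A = A^T.
Proof.
move=> hA; have uA := SO_unit hA.
by rewrite -[RHS]mulmx1 -(mulmxV uA) mulmxA (SO_trmul hA) mul1mx.
Qed.

(** Row [i] has norm 1, so the squares of its off-diagonal entries sum to 0. *)
Lemma orthogonal_row_eq {n} (A : 'M[R]_n) i :
  A *m A^T = 1%:M -> A i i = 1 -> forall j, A i j = (i == j)%:R.
Proof.
move=> oA Aii; have := congr1 (fun B : 'M[R]_n => B i i) oA.
rewrite !mxE eqxx (bigD1 i)//= mxE Aii mulr1.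
move=> /eqP; rewrite -[X in _ == X]addr0 (inj_eq (addrI _)) psumr_eq0;
  last by move=> k _; rewrite mxE -expr2 sqr_ge0.
move=> /allP h j.
have [<-//|ij] := eqVneq i j; apply/eqP.
by have := h j (mem_index_enum _); rewrite eq_sym ij mxE/= mulf_eq0 orbb.
Qed.

Section LieGroup.
Context {n : nat}.
Local Notation M := 'M[R]_n.+1.

Lemma SO_subgroup : subgroup_GL (SO R n.+1).
Proof.
split=> [|g h|g hg]; [exact: SO1|exact: SO_mul|].
by split; [exact: SO_unit|rewrite SO_inv//; exact: SO_tr].
Qed.

Lemma SO_closed : closed (SO R n.+1).
Proof.
pose f (A : M) := A *m A^T; pose g (A : M) := \det A.
have -> : SO R n.+1 = f @^-1` [set 1%:M] `&` g @^-1` [set 1] by [].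
have idc (A : M) : {for A, continuous id} by exact: cvg_id.
have set1_closed (T : normedModType R) (x : T) : closed [set x].
  exact/accessible_closed_set1/hausdorff_accessible/norm_hausdorff.
apply: closedI; apply: closed_comp; do ?exact: set1_closed.
  by move=> A _; exact: (continuous_mulmx (idc A) (continuous_trmx (idc A))).
by move=> A _; exact: (continuous_det (idc A)).
Qed.

Lemma SO_linear_lie_group : linear_lie_group (SO R n.+1).
Proof.
split; first exact: SO_subgroup.
by rewrite -(closure_id _).1; [move=> A []|exact: SO_closed].
Qed.

Lemma is_derive_unique (c : R -> M) (t : R) (X Y : M) :
  is_derive t (1 : R) c X -> is_derive t (1 : R) c Y -> X = Y.
Proof. by move=> [_ <-] [_ <-]. Qed.

Lemma is_derive_mulmxl (A : M) (c : R -> M) (t : R) (X : M) :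
  is_derive t (1 : R) c X -> is_derive t (1 : R) (fun x => A *m c x) (A *m X).
Proof.
move=> h; have := is_derive_mulmx (is_derive_cst A t (1 : R)) h.
by rewrite mul0mx add0r.
Qed.

Lemma is_derive_mulmxr (A : M) (c : R -> M) (t : R) (X : M) :
  is_derive t (1 : R) c X -> is_derive t (1 : R) (fun x => c x *m A) (X *m A).
Proof.
move=> h; have := is_derive_mulmx h (is_derive_cst A t (1 : R)).
by rewrite mulmx0 addr0.
Qed.

(** * The Lie algebra of a matrix group *)

Section Tangent.
Variable G : set M.
Hypothesis subG : subgroup_GL G.

Lemma tangent1D X Y : tangent G 1%:M X -> tangent G 1%:M Y ->
  tangent G 1%:M (X + Y).
Proof.
have [_ GM _] := subG; move=> [c [cG c0 dc]] [d [dG d0 dd]].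
exists (fun t => c t *m d t); split=> [t| |]; first exact: GM.
  by rewrite c0 d0 mulmx1.
by have := is_derive_mulmx dc dd; rewrite c0 d0 mulmx1 mul1mx.
Qed.

Lemma tangent1_0 : tangent G 1%:M 0.
Proof.
have [G1 _ _] := subG; exists (cst 1%:M).
by split; [|by []|exact: is_derive_cst].
Qed.

Lemma tangent1Z k X : tangent G 1%:M X -> tangent G 1%:M (k *: X).
Proof.
move=> [c [cG c0 dc]]; exists (fun t => c (k * t)); split=> //.
  by rewrite mulr0.
apply/is_derive_mxP => i j; rewrite mxE.
have h : is_derive (0 : R) (1 : R) (fun t : R => k * t) k.
  by apply: is_derive_eq; rewrite scaler1.
have dcij : is_derive (k * 0) (1 : R) (fun x => c x i j) (X i j).
  by rewrite mulr0; exact: (is_derive_mxP _ _ _).1.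
by have := is_derive1_comp dcij h; rewrite mulrC.
Qed.

(** Sums of velocities come from products of curves and multiples from reparametrizations, so it is
    enough to have curves for elementary skew matrices. *)
Lemma skew_tangent1 (X : M) : X^T = - X ->
  (forall i j, X i j != 0 -> tangent G 1%:M (skew_delta i j)) -> tangent G 1%:M X.
Proof.
move=> skX h.
(* Each unordered pair of indices is counted twice. *)
have -> : X = 2^-1 *: \sum_i \sum_j X i j *: skew_delta i j.
  rewrite (eq_bigr (fun i => \sum_j X i j *: delta_mx i j
                     + \sum_j X^T j i *: - delta_mx j i)); last first.
    by move=> i _; rewrite -big_split; apply: eq_bigr => j _; rewrite mxE scalerDr.
  rewrite big_split/= -matrix_sum_delta exchange_big/=.
  rewrite (eq_bigr (fun i => - \sum_j X^T i j *: delta_mx i j)); last first.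
    by move=> i _; rewrite -sumrN; apply: eq_bigr => j _; rewrite scalerN.
  rewrite sumrN -matrix_sum_delta skX opprK -mulr2n -(scaler_nat 2 X) scalerA mulVf ?scale1r//.
apply: tangent1Z; apply: big_ind => [|x y|i _]; [exact: tangent1_0|exact: tangent1D|].
apply: big_ind => [|x y|j _]; [exact: tangent1_0|exact: tangent1D|].
have [->|Xij] := eqVneq (X i j) 0; last by apply: tangent1Z; exact: h.
by rewrite scale0r; exact: tangent1_0.
Qed.

End Tangent.

(** * Rotations in coordinate planes *)

Section Rotation.
Variables (i j : 'I_n.+1).
Local Notation J := (skew_delta i j : M).
Local Notation rotation := (@rotation R n i j).

Lemma rotation0 : rotation 0 = 1.
Proof. by rewrite rotation.unlock sin0 cos0 subrr !scale0r !addr0. Qed.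

Lemma tr_rotation t : (rotation t)^T = rotation (- t).
Proof.
have trJ : J^T = - J by rewrite /skew_delta linearB/= !trmx_delta opprB.
move: trJ; rewrite rotation.unlock sinN cosN; move: J => K trK.
rewrite !linearD !linearZ/= trmx1 [(K * K)^T]trmx_mul trK.
by rewrite -[(- K) *m _]/(- K * - K) mulrNN scalerN scaleNr.
Qed.

Lemma rotation_derive t : is_derive t (1 : R) rotation (cos t *: J + sin t *: (J * J)).
Proof.
apply/is_derive_mxP => k l.
rewrite (_ : (fun y => _) =
  (fun y => (1 : M) k l + J k l * sin y + (J * J) k l * (1 - cos y))); last first.
  by apply/funext => y; rewrite rotation.unlock !mxE; congr (_ + _ + _); rewrite mulrC.
apply: is_derive_eq; rewrite !mxE/=.
by rewrite -![_ *: _]/(_ * _); ring.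
Qed.

Lemma rotation_derive0 : is_derive (0 : R) (1 : R) rotation J.
Proof. by have := rotation_derive 0; rewrite sin0 cos0 scale1r scale0r addr0. Qed.

Lemma rotation_continuous : continuous rotation.
Proof.
by move=> t; apply/differentiable_continuous/derivable1_diffP; case: (rotation_derive t).
Qed.

Hypothesis ij : i != j.

(** Because of [J^3 = -J], the series exp(tJ) sums to the defining formula of [rotation];
    [rotationD] then reduces to the addition formulas of sine and cosine. *)
Lemma skew_delta_cube : J * J * J = - J.
Proof.
have ji : (j == i) = false by rewrite eq_sym (negbTE ij).
have e (a b c d : 'I_n.+1) :
    (delta_mx a b : M) * delta_mx c d = delta_mx a d *+ (b == c) by exact: mul_delta_mx_cond.
rewrite /skew_delta !(mulrBl, mulrBr) !e !eqxx (negbTE ij) ji !mulr0n !mulr1n.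
rewrite !(mulrBl, mulrBr, mulNr, mulrN, sub0r, subr0, mul0r, mulr0, oppr0) !e.
by rewrite !eqxx (negbTE ij) ji !mulr0n !mulr1n; apply/matrixP => k l; rewrite !mxE; ring.
Qed.

Lemma rotationD s t : rotation (s + t) = rotation s *m rotation t.
Proof.
rewrite -[RHS]/(rotation s * rotation t) rotation.unlock.
have J3 := skew_delta_cube; set K := J * J in J3 *.
have KJ : K * J = - J by [].
have JK : J * K = - J by rewrite /K mulrA.
have KK : K * K = - K by rewrite {2}/K mulrA KJ mulNr.
rewrite sinD cosD !(mulrDl, mulrDr) !(mul1r, mulr1) -!(scalerAl, scalerAr).
rewrite KJ JK KK -/K !scalerA !scalerN.
apply/matrixP => k l; rewrite !mxE; ring.
Qed.

Lemma rotationN t : rotation t *m rotation (- t) = 1%:M.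
Proof. by rewrite -rotationD subrr rotation0. Qed.

Lemma rotation_SO t : SO R n.+1 (rotation t).
Proof.
have o s : rotation s *m (rotation s)^T = 1%:M by rewrite tr_rotation rotationN.
(* The determinant at [t] is the square of the one at [t / 2], which orthogonality makes 1. *)
split=> //; rewrite (splitr t) rotationD det_mulmx -expr2.
have /(congr1 (fun A : M => \det A)) := o (t / 2).
by rewrite det_mulmx det_tr det1 expr2.
Qed.

Lemma rotationE t k l : rotation t k l = 
  if (k == i) && (l == i) then cos t else
  if (k == i) && (l == j) then sin t else
  if (k == j) && (l == i) then - sin t else
  if (k == j) && (l == j) then cos t else (k == l)%:R.
Proof.
have ji : (j == i) = false by rewrite eq_sym (negbTE ij).
have e (a b c d : 'I_n.+1) :
    (delta_mx a b : M) * delta_mx c d = delta_mx a d *+ (b == c) by exact: mul_delta_mx_cond.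
rewrite rotation.unlock /skew_delta !(mulrBl, mulrBr) !e !eqxx (negbTE ij) ji !mulr0n !mulr1n !mxE.
have [->|ki] := eqVneq k i; rewrite ?(negbTE ij) ?ji/=.
  have [->|li] := eqVneq l i; rewrite ?(negbTE ij) ?ji ?eqxx/=; first by ring.
by case: (eqVneq l j) => _ /=; ring.
have [->|kj] := eqVneq k j; rewrite ?(negbTE ij) ?ji/=; last by rewrite ?andbF/=; ring.
have [->|li] := eqVneq l i; rewrite ?(negbTE ij) ?ji ?eqxx/=; first by ring.
by case: (eqVneq l j) => _ /=; ring.
Qed.

End Rotation.

(** Differentiating [c c^T = 1] at 0 gives skewness. Conversely, the elementary skew matrices are
    the velocities of the plane rotations. *)
Lemma tangent_SO1 (X : M) : tangent (SO R n.+1) 1%:M X <-> X^T = - X.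
Proof.
split=> [[c [cG c0 dc]]|skX].
  have := is_derive_mulmx dc (is_derive_trmx dc).
  rewrite c0 trmx1 mulmx1 mul1mx.
  rewrite (_ : (fun x => _) = cst 1%:M); last first.
    by apply/funext => x; case: (cG x).
  move=> /is_derive_unique/(_ (is_derive_cst _ _ _)) /eqP.
  by rewrite addrC addr_eq0 => /eqP.
apply: skew_tangent1 => //; first exact: SO_subgroup.
move=> i j Xij; exists (rotation i j).
have ij : i != j.
  apply: contraNneq Xij => ->; have /matrixP/(_ j j) := skX.
  by rewrite !mxE => /eqP; rewrite -addr_eq0 -mulr2n mulrn_eq0.
by split; [move=> t; exact: rotation_SO|exact: rotation0|exact: rotation_derive0].
Qed.

End LieGroup.
End SpecialOrthogonal.

(** * Connectedness of SO(n) *)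

Section Connectedness.
Context {R : realType}.

Lemma connected_real_line : connected [set: R].
Proof. by apply/connected_intervalP. Qed.

Lemma path_component {T : topologicalType} (S : set T) (c : R -> T) s t :
  continuous c -> (forall x, S (c x)) -> connected_component S (c s) (c t).
Proof.
move=> cc cS; apply: (@connected_component_max _ _ (range c)).
- by exists s.
- by move=> _ [x _ <-].
- apply: connected_continuous_connected; first exact: connected_real_line.
  exact: continuous_subspaceT.
- by exists t.
Qed.

Definition sign_mx {n} (s : 'I_n -> bool) : 'M[R]_n :=
  diag_mx (\row_i (-1) ^+ s i).

Lemma tr_sign_mx {n} (s : 'I_n -> bool) : (sign_mx s)^T = sign_mx s.
Proof. exact: tr_diag_mx. Qed.

Lemma sign_mx_sqr {n} (s : 'I_n -> bool) : sign_mx s *m sign_mx s = 1%:M.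
Proof.
apply/matrixP => i j; rewrite mul_diag_mx !mxE.
by case: eqP => [->|]; rewrite ?mulr0// mulr1n -expr2 sqrr_sign.
Qed.

(** By induction: expanding along the first row, the determinant is affine in the first sign, with
    slope the minor made nonzero by the induction hypothesis. So it cannot vanish for both signs. *)
Lemma exists_sign_mx {n} (A : 'M[R]_n) : exists s, \det (A + sign_mx s) != 0.
Proof.
elim: n A => [|n IH] A; first by exists (fun=> false); rewrite det_mx00 oner_neq0.
have [s hs] := IH (row' ord0 (col' ord0 A)).
pose s' b i := if unlift ord0 i is Some j then s j else b.
(* These cofactors omit the first row, so they do not depend on the first sign; [false] is an
   arbitrary choice. *)
pose c j := cofactor (A + sign_mx (s' false)) ord0 j.
have c0 : c ord0 = \det (row' ord0 (col' ord0 A) + sign_mx s).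
  rewrite /c /cofactor expr0 mul1r; congr (\det _).
  by apply/matrixP => i j; rewrite !mxE (inj_eq lift_inj) /s' liftK.
have E b : \det (A + sign_mx (s' b)) = (-1) ^+ b * c ord0 + \sum_j A ord0 j * c j.
  rewrite (expand_det_row _ ord0) (eq_bigr (fun j =>
      (if j == ord0 then (-1) ^+ b * c ord0 else 0) + A ord0 j * c j)); last first.
    move=> j _; have -> : cofactor (A + sign_mx (s' b)) ord0 j = c j.
      rewrite /c /cofactor; congr (_ * \det _).
      by apply/matrixP => k l; rewrite !mxE /s' liftK.
    rewrite !mxE /s' unlift_none eq_sym [in RHS](eq_sym j).
    case: (eqVneq ord0 j) => [<-|_]; last by rewrite addr0 add0r.
    by rewrite mulr1n mulrDl addrC.
  by rewrite big_split/= -big_mkcond big_pred1_eq.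
have [h|] := eqVneq (\det (A + sign_mx (s' false))) 0; last by exists (s' false).
exists (s' true); apply: contra_neq hs => h'.
by rewrite -c0; move: h h'; rewrite !E expr0 expr1; lra.
Qed.

Section SOConnected.
Context {n : nat}.
Local Notation M := 'M[R]_n.+1.
Local Notation comp := (connected_component (SO R n.+1) 1%:M).

(** Left translation by [A] carries the component of 1 to a connected set that contains [A] and
    [A B]. *)
Lemma component_mulmx (A B : M) : comp A -> comp B -> comp (A *m B).
Proof.
move=> compA compB; apply: (connected_component_trans compA).
have SA := connected_component_sub compA.
apply: (@connected_component_max _ _ ((fun B : M => A *m B) @` comp)).
- by exists 1%:M; rewrite ?mulmx1//; apply: connected_component_refl; exact: SO1.
- by move=> _ [C /connected_component_sub SC <-]; exact: SO_mul.
- apply: connected_continuous_connected; first exact: component_connected.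
  apply: continuous_subspaceT => C.
  have cA : {for C, continuous ((fun=> A) : M -> M)} by exact: cst_continuous.
  have cid : {for C, continuous id} by exact: cvg_id.
  exact: (continuous_mulmx cA cid).
- by exists B.
Qed.

Lemma rotation_component i j t : i != j -> comp (rotation i j t).
Proof.
move=> ij; rewrite [1%:M](_ : _ = rotation i j 0 :> M); last by rewrite rotation0.
by apply: path_component => [|x]; [exact: rotation_continuous|exact: rotation_SO].
Qed.

Lemma det_sign_mx m (s : 'I_m -> bool) : \det (sign_mx s) = (-1) ^+ #|s|.
Proof.
rewrite det_diag (eq_bigr (fun i => if s i then -1 else 1)); last first.
  by move=> i _; rewrite mxE; case: (s i).
by rewrite -big_mkcond/= prodr_const.
Qed.

(** Induction on the number of signs -1, which is even: two of them are removed by a rotation by pi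
    in their plane. *)
Lemma sign_mx_component (s : 'I_n.+1 -> bool) : \det (sign_mx s) = 1 ->
  comp (sign_mx s).
Proof.
rewrite det_sign_mx; have [k] := ubnP #|s|.
elim: k s => // k IH s; rewrite ltnS => sk ds.
have [i si|s0] := pickP s; last first.
  rewrite (_ : sign_mx s = 1%:M); first exact/connected_component_refl/SO1.
  by apply/matrixP => i j; rewrite !mxE; have /= -> := s0 i.
have [j /andP[/= ji sj]|s1] := pickP [predD1 s & i]; last first.
  move: ds; rewrite (cardD1 i) [i \in s]si (eq_card0 s1) expr1 => h.
  by have := @ltr01 R; move: h; lra.
pose s' := [predD1 [predD1 s & i] & j].
have s's : #|s| = #|s'|.+2.
  by rewrite (cardD1 i) [i \in s]si (cardD1 j) inE/= ji [_ \in s]sj.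
rewrite (_ : sign_mx s = rotation i j pi *m sign_mx s').
  apply: component_mulmx; first by apply: rotation_component; rewrite eq_sym.
  apply: IH; first by move: sk; rewrite s's => /ltnW.
  by move: ds; rewrite s's !exprS mulrA mulrNN !mul1r.
have {}sj : s j by []; have {}si : s i by [].
rewrite mul_mx_diag; apply/matrixP => a b.
rewrite [RHS]mxE rotationE 1?eq_sym// !mxE cospi sinpi oppr0 /s' /=.
have [<-{b}|ab] := eqVneq a b.
  have [->|ai] := eqVneq a i; first by rewrite inE eqxx si andbF mulr1.
  have [->|aj] := eqVneq a j; rewrite ?sj ?mulr1 ?mul1r ?andbF /= ?mulr1 ?inE ?ai ?mul1r//.
rewrite mulr0n; have [ai|ai] := eqVneq a i; have [aj|aj] := eqVneq a j => /=;
  have [bi|bi] := eqVneq b i; have [bj|bj] := eqVneq b j => /=; rewrite ?mul0r//.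
all: by move: ab; rewrite ?ai ?aj ?bi ?bj eqxx.
Qed.

(** * Skew matrices and the Cayley transform *)

Lemma skew_row_eq0 m (X : 'M[R]_m) (v : 'rV_m) : X^T = - X -> v *m X = v -> v = 0.
Proof.
move=> skX e.
(* The 1 x 1 matrix [v X v^T] is its own opposite since [X] is skew; here it is the squared norm of
   [v]. *)
have h : v *m v^T = - (v *m v^T).
  have : (v *m X *m v^T)^T = - (v *m X *m v^T).
    by rewrite !trmx_mul trmxK skX mulNmx mulmxN mulmxA.
  by rewrite e trmx_mul trmxK.
apply/rowP => j; rewrite mxE; apply/eqP.
have /matrixP/(_ ord0 ord0)/eqP := h.
rewrite [X in _ == X]mxE -addr_eq0 -mulr2n mulrn_eq0/= mxE psumr_eq0.
  move=> /allP/(_ j (mem_index_enum _)); by rewrite mxE mulf_eq0 orbb.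
by move=> k _; rewrite mxE -expr2 sqr_ge0.
Qed.

Lemma skew_unitmx m (X : 'M[R]_m) : X^T = - X -> 1%:M - X \in unitmx.
Proof.
move=> skX; rewrite unitmxE unitfE; apply/det0P => -[v v0].
rewrite mulmxBr mulmx1 => /eqP; rewrite subr_eq0 eq_sym => /eqP /(skew_row_eq0 skX) ve.
by rewrite ve eqxx in v0.
Qed.

Definition cayley m (X : 'M[R]_m) : 'M[R]_m := (1%:M + X) *m invmx (1%:M - X).

(** Transposition exchanges [1 + X] and [1 - X], which commute. This gives orthogonality, and the
    equality of their determinants gives determinant 1. *)
Lemma cayley_SO m (X : 'M[R]_m) : X^T = - X -> SO R m (cayley X).
Proof.
move=> skX; have u := skew_unitmx skX.
have u' : 1%:M + X \in unitmx by rewrite -[X]opprK; apply: skew_unitmx; rewrite linearN/= skX.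
have trD : (1%:M + X)^T = 1%:M - X by rewrite linearD/= trmx1 skX.
have trB : (1%:M - X)^T = 1%:M + X by rewrite linearB/= trmx1 skX opprK.
have com : (1%:M + X) *m (1%:M - X) = (1%:M - X) *m (1%:M + X).
  by rewrite !(mulmxDl, mulmxDr, mulmxN, mulNmx) !mulmx1 !mul1mx; move: (X *m X) => Y;
    apply/matrixP => a b; rewrite !mxE; ring.
split.
  rewrite /cayley trmx_mul trmx_inv trD trB mulmxA -(mulmxA (1%:M + X)).
  have -> : invmx (1%:M - X) *m invmx (1%:M + X) = invmx (1%:M + X) *m invmx (1%:M - X).
    apply: (can_inj (mulKmx u)); rewrite mulKVmx//.
    apply: (can_inj (mulKmx u')); rewrite mulmxV// mulmxA com -mulmxA mulKVmx// mulmxV//.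
  by rewrite mulmxA mulmxV// mul1mx mulVmx.
rewrite /cayley det_mulmx det_inv -[1%:M - X]trD det_tr divff//.
by move: u'; rewrite unitmxE unitfE.
Qed.

(** The path [t -> cayley (t X)] joins 1 to [cayley X]; it is defined throughout because multiples
    of skew matrices are skew. *)
Lemma cayley_component (X : M) : X^T = - X -> comp (cayley X).
Proof.
move=> skX; have sk (t : R) : (t *: X)^T = - (t *: X) by rewrite linearZ/= skX scalerN.
have <- : cayley (0 *: X) = 1%:M by rewrite /cayley scale0r addr0 subr0 invmx1 mulmx1.
rewrite -[in cayley X](scale1r X).
apply: (path_component (c := fun t => cayley (t *: X))) => t; last exact: cayley_SO.
have c1 : {for t, continuous ((fun=> 1%:M) : R -> M)} by exact: cst_continuous.
have cX : {for t, continuous (fun s : R => s *: X)} by exact: scalel_continuous.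
have u s : 1%:M - s *: X \in unitmx by exact: skew_unitmx.
exact: (continuous_mulmx (continuousD c1 cX) (continuous_invmx u (continuousB c1 cX))).
Qed.

Lemma orthogonal_cayley m (A : 'M[R]_m) : A *m A^T = 1%:M ->
  \det (1%:M + A) != 0 -> exists2 X, X^T = - X & A = cayley X.
Proof.
move=> oA dA; have u : 1%:M + A \in unitmx by rewrite unitmxE unitfE.
have u' : 1%:M + A^T \in unitmx.
  by rewrite -[1%:M]trmx1 -linearD/= unitmx_tr.
have oA' : A^T *m A = 1%:M by rewrite mulmx1C.
(* The inverse Cayley transform of [A]. *)
pose X := (A - 1%:M) *m invmx (1%:M + A).
have XE : X *m (1%:M + A) = A - 1%:M by rewrite mulmxKV.
have skX : X^T = - X.
  have e : (1%:M + A^T) *m X^T = A^T - 1%:M.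
    have := congr1 trmx XE; rewrite trmx_mul.
    by rewrite linearD/= trmx1 => ->; rewrite linearB/= trmx1.
  (* Clearing the denominators [1 + A^T] on the left and [1 + A] on the right leaves a consequence
     of [A^T A = 1]. *)
  apply: (can_inj (mulKmx u')); apply: (can_inj (mulmxK u)).
  rewrite e mulmxN mulNmx -mulmxA XE.
  rewrite !(mulmxDl, mulmxDr, mulmxN, mulNmx) !mulmx1 !mul1mx oA';
    apply/matrixP => a b; rewrite !mxE; ring.
exists X => //; have uX := skew_unitmx skX.
apply: (can_inj (mulmxK uX)); rewrite mulmxKV//.
apply: (can_inj (mulmxK u)); rewrite mulmxDl mul1mx XE.
rewrite mulmxBr mulmxBl mulmx1 -mulmxA XE mulmxDr mulmxBr !mulmx1.
by move: (A *m A) => Y; apply/matrixP => a b; rewrite !mxE; ring.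
Qed.

Lemma SO_connected : connected (SO R n.+1).
Proof.
rewrite (_ : SO R n.+1 = comp); first exact: component_connected.
rewrite eqEsubset; split=> [A SA|]; last exact: connected_component_sub.
have [s hs] := exists_sign_mx A; pose D := sign_mx s.
have trD : D^T = D by exact: tr_sign_mx.
have DD : D *m D = 1%:M by exact: sign_mx_sqr.
have [oA dA] := SA.
have oDA : D *m A *m (D *m A)^T = 1%:M.
  by rewrite trmx_mul trD mulmxA -(mulmxA D) oA mulmx1 DD.
have [X skX DAX] : exists2 X, X^T = - X & D *m A = cayley X.
  apply: orthogonal_cayley => //.
  (* [1 + D A = D (D + A)] because [D] is its own inverse. *)
  rewrite -DD -mulmxDr det_mulmx mulf_neq0 1?addrC// det_sign_mx.
  by rewrite signr_eq0.
(* A Cayley transform has determinant 1, and so has [A]; hence so has the sign matrix. *)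
have dD : \det D = 1.
  by have [_] := cayley_SO skX; rewrite -DAX det_mulmx dA mulr1.
have -> : A = D *m cayley X by rewrite -DAX mulmxA DD mul1mx.
by apply: component_mulmx; [exact: sign_mx_component|exact: cayley_component].
Qed.

End SOConnected.
End Connectedness.

(** * The subgroup SO(3) of SO(5) *)

Local Notation i0 := (Ordinal (isT : 0 < 5)%N).
Local Notation i1 := (Ordinal (isT : 1 < 5)%N).
Local Notation i2 := (Ordinal (isT : 2 < 5)%N).
Local Notation i3 := (Ordinal (isT : 3 < 5)%N).
Local Notation i4 := (Ordinal (isT : 4 < 5)%N).

Lemma ord5P (P : 'I_5 -> Prop) :
  P i0 -> P i1 -> P i2 -> P i3 -> P i4 -> forall i, P i.
Proof.
move=> P0 P1 P2 P3 P4 [[|[|[|[|[|//]]]]] lti];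
by rewrite (bool_irrelevance lti isT).
Qed.

Lemma sum5 (V : nmodType) (F : 'I_5 -> V) :
  \sum_i F i = F i0 + F i1 + F i2 + F i3 + F i4.
Proof.
rewrite !big_ord_recl big_ord0 addr0 !addrA.
by do ![congr (_ + _)]; congr F; apply: val_inj.
Qed.

Section SO3inSO5.
Context {R : realType}.
Local Notation M := 'M[R]_5.
Local Notation G := (SO R 5).
Local Notation H := (@SO3_in_SO5 R).

(** By unit length, the two diagonal entries 1 force the first two rows and columns to be those of
    the identity. This description is used below in place of the blocks. *)
Lemma SO3_in_SO5P A : H A <-> [/\ G A, A i0 i0 = 1 & A i1 i1 = 1].
Proof.
pose j0 : 'I_2 := ord0; pose j1 : 'I_2 := ord_max.
have e0 : i0 = lshift 3 j0 by exact: val_inj.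
have e1 : i1 = lshift 3 j1 by exact: val_inj.
split=> [[B [oB dB] <-]|[[oA dA] A0 A1]].
  split; last 2 first.
  - by rewrite e0 [LHS](@block_mxEul _ 2 3 2 3) mxE.
  - by rewrite e1 [LHS](@block_mxEul _ 2 3 2 3) mxE.
  suff : SO R (2 + 3) (block_mx 1%:M 0 0 B) by [].
  split; last by rewrite det_ublock dB det1 mulr1.
  rewrite tr_block_mx mulmx_block !trmx0 trmx1 !(mulmx0, mul0mx) mulmx1 oB.
  by rewrite !addr0 add0r -scalar_mx_block.
have oA' : A^T *m A^T^T = 1%:M by rewrite trmxK mulmx1C.
have r0 := orthogonal_row_eq oA A0; have r1 := orthogonal_row_eq oA A1.
have c0 j : A j i0 = (i0 == j)%:R by rewrite -(orthogonal_row_eq oA') mxE.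
have c1 j : A j i1 = (i1 == j)%:R by rewrite -(orthogonal_row_eq oA') mxE.
have j01 (i : 'I_2) : i = j0 \/ i = j1.
  by case: i => -[|[|//]] lti; [left|right]; exact: val_inj.
have AE : A = block_mx (1%:M : 'M[R]_2) 0 0 (drsubmx (A : 'M[R]_(2 + 3))) :> 'M[R]_(2 + 3).
  apply: (etrans (esym (@submxK _ 2 3 2 3 A))); congr block_mx.
  - apply/matrixP => i j; rewrite !mxE.
    by case: (j01 i) => ->; rewrite -?e0 -?e1 ?r0 ?r1 -val_eqE/=.
  - apply/matrixP => i j; rewrite !mxE.
    by case: (j01 i) => ->; rewrite -?e0 -?e1 ?r0 ?r1 -val_eqE/=.
  - apply/matrixP => i j; rewrite !mxE.
    by case: (j01 j) => ->; rewrite -?e0 -?e1 ?c0 ?c1 -val_eqE/=.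
set B := drsubmx (A : 'M[R]_(2 + 3)) in AE *.
have : SO R (2 + 3) (block_mx 1%:M 0 0 B) by rewrite -AE.
move=> [oB dB]; exists B => //; split.
  move: oB; rewrite tr_block_mx mulmx_block !trmx0 trmx1 !(mulmx0, mul0mx) mulmx1.
  by rewrite !addr0 add0r scalar_mx_block => /eq_block_mx[].
by move: dB; rewrite det_ublock det1 mul1r.
Qed.

Lemma SO3_entries A : H A -> [/\ forall j, A i0 j = (i0 == j)%:R,
  forall j, A i1 j = (i1 == j)%:R, forall j, A j i0 = (j == i0)%:R &
  forall j, A j i1 = (j == i1)%:R].
Proof.
move=> /SO3_in_SO5P [[oA _] A0 A1].
have oA' : A^T *m A^T^T = 1%:M by rewrite trmxK mulmx1C.
split=> j; [exact: orthogonal_row_eq|exact: orthogonal_row_eq| |].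
  by rewrite eq_sym -(orthogonal_row_eq oA') mxE.
by rewrite eq_sym -(orthogonal_row_eq oA') mxE.
Qed.

Lemma SO3_sub A : H A -> G A.
Proof. by move=> /SO3_in_SO5P []. Qed.

Lemma SO3_mul A B : H A -> H B -> H (A *m B).
Proof.
move=> hA hB; have [A0 A1 _ _] := SO3_entries hA; have [B0 B1 _ _] := SO3_entries hB.
apply/SO3_in_SO5P; split; first by apply: SO_mul; exact: SO3_sub.
  by rewrite mxE sum5 !A0 !B0/=; ring.
by rewrite mxE sum5 !A1 !B1/=; ring.
Qed.

Lemma SO3_tr A : H A -> H A^T.
Proof.
by move=> /SO3_in_SO5P [/SO_tr ? A0 A1]; apply/SO3_in_SO5P; rewrite !mxE.
Qed.

Lemma SO3_rotation (i j : 'I_5) (t : R) : i != j -> (1 < i)%N -> (1 < j)%N -> H (rotation i j t).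
Proof.
move=> ij gi gj; apply/SO3_in_SO5P; split; first exact: rotation_SO.
all: by rewrite rotationE//; case: i j ij gi gj => -[|[|i]] lti [[|[|j]] ltj].
Qed.

Lemma SO3_comm_rotation A t : H A -> A *m rotation i0 i1 t = rotation i0 i1 t *m A.
Proof.
move=> /SO3_entries[r0 r1 c0 c1]; apply/matrixP => i j.
rewrite !mxE !sum5 !rotationE//.
by elim/ord5P: i; elim/ord5P: j; rewrite !(r0, r1, c0, c1)/=; ring.
Qed.

Lemma SO3_subgroup : subgroup_GL H.
Proof.
split=> [|g h|g hg]; [|exact: SO3_mul|].
  by apply/SO3_in_SO5P; split; rewrite ?mxE//; exact: SO1.
by have gg := SO3_sub hg; split; [exact: SO_unit|rewrite SO_inv//; exact: SO3_tr].
Qed.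

Lemma SO3_closed_subgroup : closed_subgroup G H.
Proof.
split; [exact: SO3_subgroup|by move=> A /SO3_sub|].
move=> A [clA GA]; apply/SO3_in_SO5P.
have cl (i : 'I_5) : closed [set B : M | B i i = 1].
  apply: (@closed_comp _ _ (fun B : M => B i i) [set 1]).
    by move=> B _; exact: coord_continuous.
  exact/accessible_closed_set1/hausdorff_accessible/norm_hausdorff.
have sub i : H `<=` [set B : M | B i i = 1] -> A i i = 1.
  by move=> /closure_subset/(_ _ clA); rewrite -(closure_id _).1//; exact: cl.
split=> //; apply: sub => B; first by case/SO3_in_SO5P.
by case/SO3_in_SO5P.
Qed.

End SO3inSO5.

(** * Two centralizers in SO(5) *)

Section Centralizers.
Context {R : realType}.
Local Notation M := 'M[R]_5.
Local Notation G := (SO R 5).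
Local Notation H := (@SO3_in_SO5 R).

(** [acos x] is right up to the sign of the sine. *)
Lemma exists_angle (x y : R) : x ^+ 2 + y ^+ 2 = 1 ->
  exists t, cos t = x /\ sin t = y.
Proof.
move=> xy; have x1 : -1 <= x <= 1.
  by rewrite -ler_norml -(@expr_le1 _ 2)// -normrX ger0_norm ?sqr_ge0//; nra.
have [_ cx] := acos_def x1.
have : sin (acos x) ^+ 2 = y ^+ 2.
  by have := cos2Dsin2 (acos x); rewrite cx -xy => /addrI.
move=> /eqP; rewrite eqf_sqr => /orP[/eqP h|/eqP h]; first by exists (acos x).
by exists (- acos x); rewrite cosN sinN h opprK.
Qed.

Lemma sign_mx_rotation {n} (s : 'I_n.+1 -> bool) (i j : 'I_n.+1) t : i != j ->
  sign_mx s *m rotation i j t =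
  rotation i j (if s i (+) s j then - t else t) *m (sign_mx s : 'M[R]_n.+1).
Proof.
move=> ij; rewrite mul_diag_mx mul_mx_diag; apply/matrixP => k l.
rewrite !(rotationE ij, mxE).
case: (eqVneq k i) => ki; case: (eqVneq k j) => kj;
  case: (eqVneq l i) => li; case: (eqVneq l j) => lj => /=.
all: try by move: ij; rewrite -?ki -?kj -?li -?lj eqxx.
all: rewrite ?ki ?kj ?li ?lj ?eqxx ?(negbTE ij) 1?eq_sym ?(negbTE ij) ?(negbTE li) ?(negbTE lj).
all: rewrite ?mulr0 ?mul0r//.
all: try by case: eqVneq => [<-|_]; rewrite ?mulr0 ?mul0r ?mulr1 ?mul1r.
all: case: (s i) => //=; case: (s j) => //=; rewrite ?cosN ?sinN; try ring.
Qed.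

Lemma sign_mx_comm (s : 'I_5 -> bool) (A : M) : sign_mx s *m A = A *m sign_mx s ->
  forall i j, s i != s j -> A i j = 0.
Proof.
move=> /matrixP h i j sij; have := h i j; rewrite mul_diag_mx mul_mx_diag !mxE.
move: sij; case: (s i); case: (s j) => //= _; rewrite ?expr0 ?expr1; lra.
Qed.

Lemma rotation_pi_sign (i j : 'I_5) : i != j ->
  rotation i j pi = sign_mx (fun k => (k == i) || (k == j)) :> M.
Proof.
move=> ij; apply/matrixP => k l; rewrite rotationE// !mxE cospi sinpi oppr0.
have [<-{l}|kl] := eqVneq k l.
  case: (eqVneq k i) => ki; case: (eqVneq k j) => kj //=.
case: (eqVneq k i) => ki; case: (eqVneq k j) => kj;
  case: (eqVneq l i) => li; case: (eqVneq l j) => lj => //=.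
all: by move: kl; rewrite ?ki ?kj ?li ?lj eqxx.
Qed.

Lemma rotation_pi_comm (i j : 'I_5) (A : M) : i != j ->
  rotation i j pi *m A = A *m rotation i j pi ->
  forall k l, ((k == i) || (k == j)) != ((l == i) || (l == j)) -> A k l = 0.
Proof. by move=> ij; rewrite rotation_pi_sign// => /sign_mx_comm. Qed.

(** The reflection [diag(-1, 1)] of the plane (0, 1), with -1 on the last three coordinates: it
    still commutes with [H], and its determinant is 1. *)
Definition w0 : M := sign_mx (fun i => i != i1).

Lemma w0_SO : G w0.
Proof.
split; last first.
  rewrite det_sign_mx (_ : #|_| = 4%N); first by rewrite -signr_odd.
  by rewrite cardC1 card_ord.
by rewrite tr_sign_mx sign_mx_sqr.
Qed.

(** Commuting with half turns kills every entry outside the diagonal and the upper left 2 x 2 block;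
    commuting with quarter turns makes the lower block a scalar [l]. The upper block is orthogonal
    of determinant [e], and the total determinant 1 forces [l = e]. *)
Lemma centralizer_SO3 (y : M) : G y -> (forall h, H h -> h *m y = y *m h) ->
  exists t, y = rotation i0 i1 t \/ y = w0 *m rotation i0 i1 t.
Proof.
move=> [oy dy] cy.
have c23 := cy _ (SO3_rotation (pi / 2) (isT : i2 != i3) isT isT).
have c34 := cy _ (SO3_rotation (pi / 2) (isT : i3 != i4) isT isT).
have n23 : i2 != i3 by []. have n34 : i3 != i4 by [].
have z23 := rotation_pi_comm n23 (cy _ (SO3_rotation pi n23 isT isT)).
have z34 := rotation_pi_comm n34 (cy _ (SO3_rotation pi n34 isT isT)).
have y02 := z23 i0 i2 isT; have y03 := z23 i0 i3 isT; have y04 := z34 i0 i4 isT.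
have y12 := z23 i1 i2 isT; have y13 := z23 i1 i3 isT; have y14 := z34 i1 i4 isT.
have y20 := z23 i2 i0 isT; have y30 := z23 i3 i0 isT; have y40 := z34 i4 i0 isT.
have y21 := z23 i2 i1 isT; have y31 := z23 i3 i1 isT; have y41 := z34 i4 i1 isT.
have y23 := z34 i2 i3 isT; have y24 := z34 i2 i4 isT; have y34 := z23 i3 i4 isT.
have y32 := z34 i3 i2 isT; have y42 := z34 i4 i2 isT; have y43 := z23 i4 i3 isT.
have yE := (y02, y03, y04, y12, y13, y14, y20, y30, y40, y21, y31, y41,
            y23, y24, y34, y32, y42, y43).
have e33 : y i3 i3 = y i2 i2.
  have /matrixP/(_ i2 i3) := c23; rewrite !mxE !sum5 !rotationE//= cos_pihalf sin_pihalf.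
  by rewrite !yE; lra.
have e44 : y i4 i4 = y i2 i2.
  have /matrixP/(_ i3 i4) := c34; rewrite !mxE !sum5 !rotationE//= cos_pihalf sin_pihalf.
  by rewrite !yE e33; lra.
have /matrixP o := oy.
have := o i2 i2; have := o i0 i0; have := o i1 i1; have := o i0 i1.
rewrite !mxE !sum5 !mxE !yE /= !(mulr0, mul0r, addr0, add0r).
set a := y i0 i0; set b := y i0 i1; set c := y i1 i0; set d := y i1 i1.
set l := y i2 i2 => o01 o11 o00 o22.
pose e := a * d - b * c.
have cE : c = - (e * b).
  have : c + e * b = c * (1 - (a * a + b * b)) + a * (a * c + b * d) by rewrite /e; ring.
  by rewrite o00 o01; lra.
have dE : d = e * a.
  have : d - e * a = d * (1 - (a * a + b * b)) + b * (a * c + b * d) by rewrite /e; ring.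
  by rewrite o00 o01; lra.
have e2 : e ^+ 2 = 1.
  have : e ^+ 2 = (a * a + b * b) * (c * c + d * d) - (a * c + b * d) ^+ 2 by rewrite /e; ring.
  by rewrite o00 o01 o11; lra.
(* The angle is read off row 1, on which [D] below acts as 1. *)
have [t [ct st]] : exists t, cos t = d /\ sin t = - c by apply: exists_angle; lra.
pose D : M := diag_mx (\row_i (if i == i0 then e else if i == i1 then 1 else l)).
have yD : y = D *m rotation i0 i1 t.
  rewrite mul_diag_mx; apply/matrixP => i j; rewrite mxE rotationE// ct st !mxE.
  elim/ord5P: i; elim/ord5P: j; rewrite /= ?yE ?e33 ?e44 -/a -/b -/c -/d -/l;
    rewrite ?mulr0 ?mulr1 ?mul1r ?opprK //; rewrite ?cE ?dE.
  - by rewrite mulrA -expr2 e2 mul1r.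
  - by rewrite opprK mulrA -expr2 e2 mul1r.
(* The determinant of [y] is [e l^3], and [l^2 = 1]. *)
have el : e * l = 1.
  have [_ dr] := rotation_SO (isT : i0 != i1) t.
  move: dy; rewrite yD det_mulmx dr mulr1 det_diag.
  rewrite !big_ord_recl big_ord0 !mxE /= => dy.
  have -> : e * l = e * l * (l * l) by rewrite o22 mulr1.
  by rewrite -dy; ring.
have le : l = e by rewrite -[LHS]mul1r -e2; rewrite expr2 -mulrA el mulr1.
have [e1|e1] : e = 1 \/ e = -1.
  by have := eqf_sqr e 1; rewrite expr1n e2 eqxx => /esym/orP[]/eqP; [left|right].
  exists t; left; rewrite yD -[RHS]mul1mx; congr (_ *m _).
  by apply/matrixP => i j; rewrite !mxE le e1 !if_same.
exists t; right; rewrite yD; congr (_ *m _).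
by apply/matrixP => i j; rewrite !mxE le e1; elim/ord5P: i.
Qed.

(** [y] preserves the axis 1 and the planes (0, 2) and (3, 4). It acts on (3, 4) by a rotation and
    on (0, 2) by an element of O(2), whose square is a rotation even if it is a reflection; this is
    why the conclusion concerns [y *m y]. *)
Lemma centralizer_torus (y : M) : G y -> w0 *m y = y *m w0 ->
  rotation i3 i4 (pi / 2) *m y = y *m rotation i3 i4 (pi / 2) ->
  exists s t, y *m y = rotation i0 i2 s *m rotation i3 i4 t.
Proof.
move=> [oy _] /sign_mx_comm z1 c34.
have /rotation_pi_comm-/(_ isT) z34 : rotation i3 i4 pi *m y = y *m rotation i3 i4 pi.
  by rewrite [pi]splitr rotationD// -mulmxA c34 mulmxA c34 mulmxA.
have y01 := z1 i0 i1 isT; have y21 := z1 i2 i1 isT; have y31 := z1 i3 i1 isT.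
have y41 := z1 i4 i1 isT; have y10 := z1 i1 i0 isT; have y12 := z1 i1 i2 isT.
have y13 := z1 i1 i3 isT; have y14 := z1 i1 i4 isT.
have y03 := z34 i0 i3 isT; have y04 := z34 i0 i4 isT; have y23 := z34 i2 i3 isT.
have y24 := z34 i2 i4 isT; have y30 := z34 i3 i0 isT; have y40 := z34 i4 i0 isT.
have y32 := z34 i3 i2 isT; have y42 := z34 i4 i2 isT.
have yE := (y01, y21, y31, y41, y10, y12, y13, y14, y03, y04, y23, y24, y30, y40,
  y32, y42).
have e44 : y i4 i4 = y i3 i3.
  have /matrixP/(_ i3 i4) := c34; rewrite !mxE !sum5 !rotationE//= cos_pihalf sin_pihalf.
  by rewrite !yE; lra.
have e43 : y i4 i3 = - y i3 i4.
  have /matrixP/(_ i3 i3) := c34; rewrite !mxE !sum5 !rotationE//= cos_pihalf sin_pihalf.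
  by rewrite !yE; lra.
have /matrixP o := oy; have /matrixP o' := mulmx1C oy.
have := o i0 i0; have := o i2 i2; have := o i0 i2; have := o i1 i1; have := o i3 i3.
have := o' i0 i0; have := o' i2 i2; have := o' i0 i2.
rewrite !mxE !sum5 !mxE !yE /= !(mulr0, mul0r, addr0, add0r).
set a := y i0 i0; set b := y i0 i2; set c := y i2 i0; set d := y i2 i2.
set e := y i1 i1; set f := y i3 i3; set g := y i3 i4.
move=> p02 p22 p00 o33 o11 o02 o22 o00.
(* In the squared (0, 2) block, the off-diagonal entries [b (a + d)] and [c (a + d)] are opposite
   and the diagonal entries equal. *)
have bc : (b + c) * (a + d) = 0 by lra.
have ad : a ^+ 2 = d ^+ 2 by lra.
have [s [cs ss]] : exists s, cos s = a ^+ 2 + b * c /\ sin s = b * (a + d).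
  apply: exists_angle.
  have -> : (a ^+ 2 + b * c) ^+ 2 + (b * (a + d)) ^+ 2 =
    a * a * (a * a + b * b) + b * b * (c * c + d * d) + 2 * a * b * (a * c + b * d) by ring.
  by rewrite o00 o22 o02; lra.
(* Doubling of the angle in the plane (3, 4). *)
have [t [ct st]] : exists t, cos t = f ^+ 2 - g ^+ 2 /\ sin t = 2 * f * g.
  apply: exists_angle.
  have -> : (f ^+ 2 - g ^+ 2) ^+ 2 + (2 * f * g) ^+ 2 = (f * f + g * g) ^+ 2 by ring.
  by rewrite o33; lra.
exists s, t; apply/matrixP => i j; rewrite !mxE !sum5 !rotationE// cs ss ct st.
elim/ord5P: i; elim/ord5P: j; rewrite /= !yE ?e44 ?e43 -/a -/b -/c -/d -/e -/f -/g.
all: rewrite ?(mulr0, mul0r, addr0, add0r)//.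
all: try by ring.
all: lra.
Qed.

End Centralizers.

(** * SO(5)/SO(3) is not a symmetric space *)

(** Near each point of the curve, [f] agrees on [S] with a continuous map. *)
Lemma smooth_on_curve {R : realType} {U V : normedModType R} (S : set U) (f : U -> V)
    (c : R -> U) : smooth_on S f -> (forall t, S (c t)) -> continuous c ->
  continuous (f \o c).
Proof.
move=> sf cS cc t; have [A [F [oA At CF FE]]] := sf _ (cS t).
have [cF _] := CF 0%N.
have cFc : {for t, continuous (F \o c)} by apply: continuous_comp; [exact: cc|exact: cF].
rewrite /continuous_at/= -(FE _ At (cS t)); apply: cvg_trans cFc.
apply: near_eq_cvg; near=> s => /=; rewrite FE//.
by near: s; apply: cc; exact: open_nbhs_nbhs.
Unshelve. all: by end_near. Qed.

Section NotSymmetric.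
Context {R : realType}.
Local Notation M := 'M[R]_5.
Local Notation G := (SO R 5).
Local Notation H := (@SO3_in_SO5 R).
Local Notation r01 := (@rotation R 4 i0 i1).
Local Notation r02 := (@rotation R 4 i0 i2).
Local Notation r34 := (@rotation R 4 i3 i4).

Let n01 : i0 != i1 := isT.
Let n02 : i0 != i2 := isT.
Let n34 : i3 != i4 := isT.

(* Since s is an involution, a curve c (s c) as in the last clause consists of
   fixed points of s. *)
Definition symmetry_of_SO3 (s : M -> M) : Prop :=
  [/\ forall g, G g -> G (s g),
      forall g h, G g -> G h -> s (g *m h) = s g *m s h,
      forall g, G g -> s (s g) = g,
      forall h, H h -> s h = h
    & forall c : R -> M, continuous c -> (forall t, G (c t)) -> c 0 = 1%:M ->
        (forall t, c t *m s (c t) = s (c t) *m c t) ->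
        forall t, H (c t *m s (c t))].

Lemma rotation_SO3_eq1 (i : 'I_5) j t : i != j -> (i < 2)%N -> H (rotation i j t) ->
  rotation i j t = 1%:M :> M.
Proof.
move=> ij ilt2 /SO3_entries[r0 r1 _ _].
have i01 : i = i0 \/ i = i1.
  by case: i {ij r0 r1} ilt2 => -[|[|//]] lti _; [left|right]; exact: val_inj.
have E k : rotation i j t i k = (i == k)%:R :> R.
  by case: i01 ij r0 r1 => -> ij r0 r1; [exact: r0|exact: r1].
have := E i; have := E j; rewrite !(rotationE ij) eqxx (negbTE ij) eq_sym (negbTE ij) !eqxx/= => s0 c1.
by rewrite rotation.unlock s0 c1 subrr !scale0r !addr0.
Qed.

Lemma rotation_inv_eq (i j : 'I_5) s t : i != j ->
  rotation i j (s + t) = 1%:M :> M -> rotation i j t = rotation i j (- s) :> M.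
Proof.
move=> ij e; have -> : t = - s + (s + t) by rewrite addKr.
by rewrite rotationD// e mulmx1.
Qed.

Lemma w0_rotation01 t : w0 *m r01 t = r01 (- t) *m w0.
Proof. exact: sign_mx_rotation. Qed.

Lemma w0_rotation02 t : w0 *m r02 t = r02 t *m w0.
Proof. exact: sign_mx_rotation. Qed.

Lemma rotation_pi02 t : r01 pi *m r02 t = r02 (- t) *m r01 pi.
Proof. by rewrite rotation_pi_sign//; exact: sign_mx_rotation. Qed.

Lemma rotation_pi34 t : r01 pi *m r34 t = r34 t *m r01 pi.
Proof. by rewrite rotation_pi_sign//; exact: sign_mx_rotation. Qed.

Lemma rotation0234 s t : r02 s *m r34 t = r34 t *m r02 s.
Proof.
have e (a b c d : 'I_5) :
    (delta_mx a b : M) * delta_mx c d = delta_mx a d *+ (b == c) by exact: mul_delta_mx_cond.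
have JJ : skew_delta i0 i2 * skew_delta i3 i4 = 0 :> M.
  by rewrite /skew_delta !(mulrBl, mulrBr) !e/= !mulr0n !subr0.
have JJ' : skew_delta i3 i4 * skew_delta i0 i2 = 0 :> M.
  by rewrite /skew_delta !(mulrBl, mulrBr) !e/= !mulr0n !subr0.
have JJJ : skew_delta i0 i2 * skew_delta i0 i2 * skew_delta i3 i4 = 0 :> M.
  by rewrite -mulrA JJ mulr0.
have JJJ' : skew_delta i3 i4 * skew_delta i3 i4 * skew_delta i0 i2 = 0 :> M.
  by rewrite -mulrA JJ' mulr0.
rewrite -[LHS]/(r02 s * r34 t) -[RHS]/(r34 t * r02 s) rotation.unlock.
move: JJ JJ' JJJ JJJ'; move: (skew_delta i0 i2) (skew_delta i3 i4) => J K JJ JJ' JJJ JJJ'.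
rewrite !(mulrDl, mulrDr) !(mul1r, mulr1) -!scalerAl -!scalerAr !mulrA.
rewrite JJ JJ' JJJ JJJ' !mul0r !scaler0 !addr0.
by move: (J * J) (K * K) => J2 K2; apply/matrixP => k l; rewrite !mxE; ring.
Qed.

Section Symmetry.
Variable s : M -> M.
Hypothesis hs : symmetry_of_SO3 s.

(** The image of a rotation commutes with [H], hence lies in the O(2) of [centralizer_SO3]; it is
    itself a rotation, being the square of the image of the half angle. Its product with the
    original rotation lies in [H], so that product is trivial. *)
Lemma symmetry_r01 t : s (r01 t) = r01 (- t).
Proof.
have [sG sM sK sH sF] := hs.
have sr a : exists b, s (r01 a) = r01 b.
  have Gr : G (r01 (a / 2)) by exact: rotation_SO.
  have [|b [E|E]] := centralizer_SO3 (sG _ Gr).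
  - move=> h Hh; have Gh := SO3_sub Hh.
    rewrite -{1}(sH h)// -sM//.
    by rewrite SO3_comm_rotation// sM// (sH h).
  - by exists (b + b); rewrite [a]splitr !rotationD// sM// E.
  (* A reflection squares to the identity, the rotation of angle 0. *)
  - exists 0; rewrite [a]splitr rotationD// sM// E rotation0.
    by rewrite {2}w0_rotation01 mulmxA -(mulmxA w0) rotationN// mulmx1 sign_mx_sqr.
have [b E] := sr t; rewrite E; apply: (@rotation_inv_eq i0 i1) => //.
apply: rotation_SO3_eq1 => //; rewrite rotationD// -E.
apply: (sF r01) => [|a||a]; [exact: rotation_continuous|exact: rotation_SO|exact: rotation0|].
by have [b' ->] := sr a; rewrite -!rotationD// addrC.
Qed.

(** [w0] commutes with [H], so [s w0] lies in the same O(2). If it were a rotation, applying [s]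
    again would make [w0] a rotation, against its entry -1 at (2, 2). *)
Lemma symmetry_w0 : exists t, s w0 = w0 *m r01 t.
Proof.
have [sG sM sK sH sF] := hs.
have [|t [E|E]] := centralizer_SO3 (sG _ w0_SO); last by exists t.
  move=> h Hh; have Gh := SO3_sub Hh.
  rewrite -{1}(sH h)// -sM//; last exact: w0_SO.
  rewrite (_ : h *m w0 = w0 *m h) ?sM ?(sH h)//; [exact: w0_SO|].
  apply/matrixP => i j; rewrite mul_diag_mx mul_mx_diag !mxE.
  have [r0 r1 c0 c1] := SO3_entries Hh.
  by elim/ord5P: i; elim/ord5P: j; rewrite ?(r0, r1, c0, c1) /=; ring.
have /matrixP/(_ i2 i2) : w0 = r01 (- t) by rewrite -symmetry_r01 -E sK//; exact: w0_SO.
rewrite !(rotationE n01, mxE)/= => h.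
have := @ltr01 R; move: h; lra.
Qed.

(** Both [w0] and the quarter turn of (3, 4) are fixed by [s] and commute with [r02], so
    [centralizer_torus] applies to the images. The curve condition on [s] identifies the first
    factor as [r02 (- a)]; it remains to remove [r34 c]. *)
Lemma symmetry_r02 : s w0 = w0 -> forall t, s (r02 t) = r02 (- t).
Proof.
have [sG sM sK sH sF] := hs; move=> sw.
have G02 t : G (r02 t) by exact: rotation_SO.
have G34 t : G (r34 t) by exact: rotation_SO.
have G01 t : G (r01 t) by exact: rotation_SO.
have H34 t : H (r34 t) by exact: SO3_rotation.
have sr a : exists b c, s (r02 a) = r02 b *m r34 c.
  have [] := @centralizer_torus _ (s (r02 (a / 2))) (sG _ (G02 _)).
  - by rewrite -{1}sw -sM ?w0_rotation02 ?sM ?sw//; exact: w0_SO.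
  - by rewrite -(sH (r34 _))// -sM// -rotation0234 sM// (sH (r34 _)).
  - by move=> b [c E]; exists b, c; rewrite [a]splitr rotationD// sM// E.
have sr' a : exists c, s (r02 a) = r02 (- a) *m r34 c.
  have [b [c E]] := sr a; exists c; rewrite E; congr (_ *m _).
  apply: rotation_inv_eq => //; apply: rotation_SO3_eq1 => //.
  have -> : r02 (a + b) = r02 a *m s (r02 a) *m r34 (- c).
    by rewrite E (rotationD n02) -!mulmxA (rotationN n34) mulmx1.
  apply: SO3_mul => //.
  apply: (sF r02) => [|//||d]; [exact: rotation_continuous|exact: rotation0|].
  have [b' [c' ->]] := sr d.
  by rewrite [LHS]mulmxA -[RHS]mulmxA -rotation0234 [RHS]mulmxA -!(rotationD n02) [d + _]addrC.
(* A half turn equals its inverse. *)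
have spi : s (r01 pi) = r01 pi.
  by rewrite symmetry_r01 -tr_rotation rotation_pi_sign// tr_sign_mx.
have sq a : exists2 c, s (r02 a) = r02 (- a) *m r34 c & r34 (c + c) = 1%:M.
  have [c E] := sr' a; exists c => //.
  (* [r01 pi] inverts [r02] and commutes with [r34], so the image under [s] of
     [r02 a *m r01 pi *m r02 a = r01 pi] yields [r34 (c + c) = 1]. *)
  have h : s (r02 a) *m s (r01 pi) *m s (r02 a) = s (r01 pi).
    rewrite -!sM//; last exact: SO_mul.
    by rewrite -mulmxA rotation_pi02 mulmxA rotationN// mul1mx.
  move: h; rewrite spi E -(mulmxA (_ *m r34 c)) (mulmxA (r01 pi)) rotation_pi02 opprK.
  rewrite -(mulmxA (r02 a)) rotation_pi34 (mulmxA (r02 a)) rotation0234 -(mulmxA (r34 c)).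
  rewrite !mulmxA -(mulmxA (r34 c)) -(rotationD n02) addNr rotation0 mulmx1.
  rewrite -(rotationD n34) => h.
  by apply: (can_inj (mulmxK (SO_unit (G01 pi)))); rewrite h mul1mx.
(* Writing [r02 t] as a square squares the factor [r34 c] away. *)
move=> t; have [c E c1] := sq (t / 2).
rewrite {1}[t]splitr (rotationD n02) sM// E -mulmxA (mulmxA (r34 c)) -rotation0234.
rewrite -(mulmxA (r02 _) (r34 c)) -(rotationD n34) c1 mulmx1 -(rotationD n02).
by rewrite -opprD -splitr.
Qed.

Lemma symmetry_w0_absurd : s w0 = w0 -> False.
Proof.
have [sG sM sK sH sF] := hs; move=> /symmetry_r02 s02.
have G02 t : G (r02 t) by exact: rotation_SO.
have G01 t : G (r01 t) by exact: rotation_SO.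
(* These are rotations of the plane (1, 2). *)
pose z t := r01 (pi / 2) *m r02 t *m r01 (- (pi / 2)).
have Gz t : G (z t) by apply: SO_mul => //; exact: SO_mul.
(* The two quarter turns differ by [r01 pi], which inverts [r02]. *)
have zE t : z t = r01 (- (pi / 2)) *m r02 (- t) *m r01 (pi / 2).
  rewrite /z; have {1}-> : pi / 2 = - (pi / 2) + pi :> R by lra.
  rewrite rotationD// -(mulmxA (r01 _)) rotation_pi02 -!mulmxA -rotationD//.
  by congr (_ *m (_ *m r01 _)); lra.
have sz t : s (z t) = z t.
  rewrite {1}/z !sM//; last exact: SO_mul.
  by rewrite s02 !symmetry_r01 opprK -zE.
have : H (z (pi / 2) *m s (z (pi / 2))).
  apply: (sF z) => [|//| |t]; last by rewrite sz.
    move=> t; apply: (@continuous_mulmx _ _ _ _ _ (fun t => r01 (pi / 2) *m r02 t) (fun=> _)).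
      apply: (@continuous_mulmx _ _ _ _ _ (fun=> _) r02); first exact: cst_continuous.
      exact: rotation_continuous.
    exact: cst_continuous.
  by rewrite /z rotation0 mulmx1 rotationN.
rewrite sz; set h := _ *m _ => Hh.
(* [h] is the half turn [z pi]. As an element of [H] it commutes with [r01], so it equals [r02 pi],
   which is not in [H]. *)
have hE : h *m r01 (pi / 2) = r01 (pi / 2) *m r02 pi.
  rewrite /h /z -!mulmxA -rotationD// addNr rotation0 mulmx1.
  by rewrite [r01 (- _) *m _]mulmxA -[r01 (- _) *m r01 _]rotationD// addNr rotation0 mul1mx
    -rotationD// -splitr.
have : h = r02 pi.
  apply: (can_inj (mulKmx (SO_unit (G01 (pi / 2))))).
  by rewrite -hE SO3_comm_rotation.
move: Hh => /[swap] -> /rotation_SO3_eq1-/(_ isT isT) /matrixP/(_ i0 i0).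
rewrite (rotationE n02) mxE/= cospi => h1.
by have := @ltr01 R; move: h1; lra.
Qed.

End Symmetry.
Definition conj01 (b : R) (g : M) : M := r01 b *m g *m r01 (- b).

Lemma conj01_SO b g : G g -> G (conj01 b g).
Proof. by move=> Gg; do ?[apply: SO_mul => //]; exact: rotation_SO. Qed.

Lemma conj01M b g h : conj01 b (g *m h) = conj01 b g *m conj01 b h.
Proof.
rewrite /conj01 -!mulmxA (mulmxA (r01 (- b)) (r01 b)) -(rotationD n01) addNr rotation0.
by rewrite mul1mx.
Qed.

Lemma conj01K b g : conj01 b (conj01 (- b) g) = g.
Proof.
rewrite /conj01 opprK -!mulmxA -(rotationD n01) subrr rotation0 mulmx1 mulmxA.
by rewrite -(rotationD n01) subrr rotation0 mul1mx.
Qed.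

Lemma conj01_SO3 b h : H h -> conj01 b h = h.
Proof.
move=> Hh; rewrite /conj01 -(SO3_comm_rotation _ Hh) -mulmxA (rotationN n01).
by rewrite mulmx1.
Qed.

Lemma symmetry_absurd (s : M -> M) : symmetry_of_SO3 s -> False.
Proof.
move=> hs; have [sG sM sK sH sF] := hs; have [t st] := symmetry_w0 hs.
(* Conjugation by [r01 b] changes [w0 *m r01 t] into [w0 *m r01 (t + 4 b)]: each of the two
   conjugations in [s'] contributes twice [b]. *)
pose b := - (t / 4).
have G01 u : G (r01 u) by exact: rotation_SO.
have CK g : conj01 (- b) (conj01 b g) = g by rewrite -{2}[b]opprK conj01K.
pose s' (g : M) := conj01 (- b) (s (conj01 b g)).
apply: (@symmetry_w0_absurd s'); last first.
  have cE u : conj01 u w0 = w0 *m r01 (- u - u).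
    by rewrite /conj01 -{1}[u]opprK -w0_rotation01 -mulmxA -(rotationD n01).
  rewrite /s' cE sM ?st//; last exact: w0_SO.
  rewrite (symmetry_r01 hs) -mulmxA -(rotationD n01) conj01M cE.
  rewrite /conj01 -!(rotationD n01) -mulmxA -(rotationD n01).
  by rewrite [X in r01 X](_ : _ = 0) ?rotation0 ?mulmx1// /b; lra.
have sG' g : G g -> G (s (conj01 b g)) by move=> Gg; apply: sG; exact: conj01_SO.
split.
- by move=> g Gg; apply: conj01_SO; exact: sG'.
- by move=> g h Gg Gh; rewrite /s' conj01M sM ?conj01M//; exact: conj01_SO.
- by move=> g Gg; rewrite /s' conj01K sK ?CK//; exact: conj01_SO.
- by move=> h Hh; rewrite /s' (@conj01_SO3 b h Hh) (sH h Hh) conj01_SO3.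
move=> c cc cG c0 comm u.
have sd v : s (conj01 b (c v)) = conj01 b (s' (c v)) by rewrite /s' conj01K.
have Hd : H (conj01 b (c u *m s' (c u))).
  rewrite conj01M -sd; apply: (sF (fun v => conj01 b (c v))) => [v|v||v].
  - have ccst (A : M) : {for v, continuous ((fun=> A) : R -> M)} by exact: cst_continuous.
    exact: (continuous_mulmx (continuous_mulmx (ccst _) (cc v)) (ccst _)).
  - exact: conj01_SO.
  - by rewrite c0 conj01_SO3//; have [] := @SO3_subgroup R.
  - by rewrite sd -!conj01M comm.
by rewrite -[X in H X]CK conj01_SO3.
Qed.

Lemma SO3_not_symmetric :
  ~ exists rho : 'Z_2 -> M -> M, gamma_symmetric G H rho.
Proof.
move=> [rho [_ _ [aut rhoD _] [fixH Hfix] _]].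
(* [rho 0] is idempotent and invertible on [G]. *)
have rho0 g : G g -> rho 0 g = g.
  move=> Gg; have [_ [t [_ tK _]]] := aut 0.
  by rewrite -[LHS]tK -?rhoD ?addr0 ?tK//; case: (aut 0) => -[h _ _] _; exact: h.
apply: (@symmetry_absurd (rho 1)); have [[sG sM sS] _] := aut 1.
have sK g : G g -> rho 1 (rho 1 g) = g.
  move=> Gg; rewrite -rhoD// (_ : 1 + 1 = 0 :> 'Z_2); last exact: val_inj.
  exact: rho0.
split=> // [h Hh|c cc cG c0 comm t]; first by have [_] := Hfix _ Hh; exact.
pose d t := c t *m rho 1 (c t).
have cd : continuous d.
  have csc := smooth_on_curve sS cG cc.
  by move=> u; exact: (continuous_mulmx (cc u) (csc u)).
have dfix u : fixed_points G rho (d u).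
  have Gd : G (d u) by apply: SO_mul => //; exact: sG.
  split=> // a; have [->|->] : a = 0 \/ a = 1.
    by case: a => -[|[|//]] lti; [left|right]; exact: val_inj.
    exact: rho0.
  by rewrite /d sM ?sK//; exact: sG.
apply: fixH.
have d0 : d 0 = 1%:M.
  have r1 : rho 1 1%:M = 1%:M.
    by have [_] := Hfix _ (let: And3 h _ _ := @SO3_subgroup R in h); exact.
  by rewrite /d c0 r1 mulmx1.
by rewrite -[in connected_component _ _]d0; exact: path_component.
Qed.

End NotSymmetric.

(** * The grading *)

Section Smooth.
Context {R : realType} {U V : normedModType R}.

Lemma class_C_cst k (O : set U) (v : V) : class_C k O (fun=> v).
Proof.
elim: k v => [|k IH] v; split=> //; try by move=> x _; exact: cst_continuous.
move=> w; split=> [x _|]; first exact: derivable_cst.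
have -> : (fun x : U => 'D_w (fun=> v) x) = (fun=> 0) by apply/funext => x; exact: derive_cst.
exact: IH.
Qed.

Lemma smooth_on_linear (S : set U) (f : {linear U -> V}) : continuous f -> smooth_on S f.
Proof.
move=> cf x _; exists setT, f; split=> // [|k]; first exact: openT.
have df y : differentiable f y by exact: linear_differentiable.
have fE v : (fun y => 'D_v f y) = (fun=> f v).
  by apply/funext => y; rewrite deriveE// diff_lin.
have cS y : setT y -> {for y, continuous f} by move=> _; exact: cf.
case: k => [|k]; split=> // v.
split=> [y _|]; first exact: diff_derivable.
by rewrite fE; exact: class_C_cst.
Qed.

End Smooth.

Section Grading.
Context {R : realType}.
Local Notation M := 'M[R]_5.
Local Notation G := (SO R 5).
Local Notation H := (@SO3_in_SO5 R).
Local Notation Gamma := ('Z_2 * 'Z_2)%type.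

(** * The characters of Z_2 x Z_2 and the action on SO(5) *)

Lemma Z2P (P : 'Z_2 -> Prop) : P 0 -> P 1 -> forall x, P x.
Proof.
move=> P0 P1 [[|[|//]] lti].
  by rewrite (_ : Ordinal lti = 0)//; exact: val_inj.
by rewrite (_ : Ordinal lti = 1)//; exact: val_inj.
Qed.

Lemma GammaP (P : Gamma -> Prop) :
  P (0, 0) -> P (1, 0) -> P (0, 1) -> P (1, 1) -> forall k, P k.
Proof. by move=> P00 P10 P01 P11 [x y]; elim/Z2P: x; elim/Z2P: y. Qed.

(** The bilinear form over F_2 whose nondegeneracy, [chi_sep], labels the characters by group
    elements. *)
Definition pairing (a k : Gamma) : 'Z_2 := a.1 * k.1 + a.2 * k.2.

Definition chi (a k : Gamma) : R := (-1) ^+ (pairing a k == 1).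

Lemma signZ2D (x y : 'Z_2) :
  (-1) ^+ (x + y == 1) = (-1) ^+ (x == 1) * (-1) ^+ (y == 1) :> R.
Proof. by elim/Z2P: x; elim/Z2P: y; rewrite /= ?expr0 ?expr1 ?mulr1 ?mulrNN ?mul1r. Qed.

Lemma chiDr a k l : chi a (k + l) = chi a k * chi a l.
Proof. by rewrite -signZ2D /chi /pairing !mulrDr addrACA. Qed.

Lemma chiDl a b k : chi (a + b) k = chi a k * chi b k.
Proof. by rewrite -signZ2D /chi /pairing !mulrDl addrACA. Qed.

Lemma chi0 k : chi 0 k = 1.
Proof. by rewrite /chi /pairing !mul0r addr0. Qed.

Lemma chi_sqr a k : chi a k * chi a k = 1.
Proof. by rewrite /chi -expr2 sqrr_sign. Qed.

Lemma N1_eq1 : ((-1 : R) = 1) -> False.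
Proof. by have := @ltr01 R; lra. Qed.

Lemma chi_eq1 k : chi (0, 1) k = 1 -> chi (1, 1) k = 1 -> k = 0.
Proof. by elim/GammaP: k; rewrite /chi /= ?expr1 => // h1 h2; case: N1_eq1. Qed.

Lemma chi_sep a b : (forall k, chi a k = chi b k) -> a = b.
Proof.
move=> h; have := h (1, 0); have := h (0, 1); rewrite /chi {h}.
elim/GammaP: a; elim/GammaP: b => //=; rewrite ?expr0 ?expr1 => h1 h2;
  by [case: (N1_eq1 h1)|case: (N1_eq1 (esym h1))|case: (N1_eq1 h2)|case: (N1_eq1 (esym h2))].
Qed.

(* The coordinate e_i of R^5 has weight deg i, so that the matrix entry (i, j)
   has weight deg i + deg j. *)
Definition deg (i : 'I_5) : Gamma :=
  if i == i0 then (0, 1) else if i == i1 then (1, 1) else 0.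

Definition weight_mx k : M := sign_mx (fun i => pairing (deg i) k == 1).

Definition weight_action (k : Gamma) (g : M) : M := weight_mx k *m g *m weight_mx k.

Lemma weight_actionE k g i j :
  weight_action k g i j = chi (deg i + deg j) k * g i j.
Proof.
rewrite /weight_action mul_mx_diag mul_diag_mx !mxE chiDl /chi.
by rewrite mulrAC.
Qed.

Lemma weight_actionK k : involutive (weight_action k).
Proof.
by move=> g; apply/matrixP => i j; rewrite !weight_actionE mulrA chi_sqr mul1r.
Qed.

Lemma weight_actionM k g h :
  weight_action k (g *m h) = weight_action k g *m weight_action k h.
Proof.
by rewrite /weight_action -!mulmxA (mulmxA (weight_mx k) (weight_mx k)) sign_mx_sqr mul1mx.
Qed.

Lemma weight_action_SO k g : G g -> G (weight_action k g).
Proof.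
move=> [og dg]; split; last first.
  rewrite /weight_action !det_mulmx dg mulr1 -det_mulmx sign_mx_sqr det1 //.
rewrite /weight_action !trmx_mul tr_sign_mx -!mulmxA (mulmxA (weight_mx k) (weight_mx k)).
by rewrite sign_mx_sqr mul1mx (mulmxA g) og mul1mx sign_mx_sqr.
Qed.

Lemma weight_action_smooth k : smooth_on G (weight_action k).
Proof.
have := @smooth_on_linear R M M G (mulmxr (weight_mx k) \o mulmx (weight_mx k)).
apply=> g /=.
have ccst (A : M) : {for g, continuous ((fun=> A) : M -> M)} by exact: cst_continuous.
have cid : {for g, continuous (id : M -> M)} by exact: cvg_id.
exact: (continuous_mulmx (continuous_mulmx (ccst _) cid) (ccst _)).
Qed.

Lemma weight_action_hom k : lie_hom G (weight_action k).
Proof.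
split; [exact: weight_action_SO|move=> g h _ _; exact: weight_actionM|].
exact: weight_action_smooth.
Qed.

Lemma weight_action_faithful : faithful_action G weight_action.
Proof.
split.
- move=> k; split; first exact: weight_action_hom.
  exists (weight_action k); split; [exact: weight_action_hom| |];
    by move=> g _; exact: weight_actionK.
- move=> k l g _; apply/matrixP => i j.
  by rewrite !weight_actionE chiDr mulrA.
move=> k fixk; have n02 : i0 != i2 by []; have n12 : i1 != i2 by [].
(* These quarter turns have an entry 1 of weight [deg i0] and [deg i1] respectively, and the two
   weights generate [Gamma]. *)
have /matrixP/(_ i0 i2) := fixk _ (rotation_SO n02 (pi / 2)).
have /matrixP/(_ i1 i2) := fixk _ (rotation_SO n12 (pi / 2)).
rewrite !weight_actionE !rotationE//= sin_pihalf !mulr1 /deg/= !addr0 => h1 h0.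
exact: chi_eq1.
Qed.

Lemma weight_action_SO3 h : H h -> forall k, weight_action k h = h.
Proof.
move=> /SO3_entries[r0 r1 c0 c1] k; apply/matrixP => i j; rewrite weight_actionE.
have [dij|] := eqVneq (deg i + deg j) 0; first by rewrite dij chi0 mul1r.
elim/ord5P: i; elim/ord5P: j; rewrite ?(r0, r1, c0, c1)//=; try by rewrite mulr0.
Qed.

Lemma fixed_entry g k i j : weight_action k g = g -> chi (deg i + deg j) k = -1 ->
  g i j = 0.
Proof.
move=> /matrixP/(_ i j); rewrite weight_actionE => e h; move: e; rewrite h; lra.
Qed.

(** The off-diagonal entries of these rows have nonzero weight, so some [k] changes their sign and
    they vanish; the row has norm 1. *)
Lemma weight_fixed_diag g (i : 'I_5) : (i < 2)%N -> fixed_points G weight_action g ->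
  g i i = 1 \/ g i i = -1.
Proof.
move=> i2 [[og _] fg].
have z j : i != j -> g i j = 0.
  move=> ij; have [k hk] : exists k, chi (deg i + deg j) k = -1; last exact: (fixed_entry (fg k)).
  move: i2 ij; elim/ord5P: i => // _; elim/ord5P: j => // _;
    by [exists (0, 1)|exists (1, 0)].
have /matrixP/(_ i i) := og; rewrite !mxE eqxx (bigD1 i)//= big1 => [|j ij]; last first.
  by rewrite z ?mul0r// eq_sym.
rewrite addr0 mxE -expr2 => /eqP; rewrite -[X in _ == X](expr1n R 2) eqf_sqr.
by case/orP => /eqP; [left|right].
Qed.

(** On fixed points the first two diagonal entries are 1 or -1. The values of each on a connected
    set form an interval, which here contains 1 and misses 0. *)
Lemma weight_fixed_component :
  connected_component (fixed_points G weight_action) 1%:M `<=` H.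
Proof.
move=> g cg; have [Gg _] := connected_component_sub cg.
have gii (i : 'I_5) : (i < 2)%N -> g i i = 1.
  move=> i2; pose f (A : M) := A i i.
  have imC : connected (f @` connected_component (fixed_points G weight_action) 1%:M).
    apply: connected_continuous_connected; first exact: component_connected.
    by apply: continuous_subspaceT; exact: coord_continuous.
  have f1 : (f @` connected_component (fixed_points G weight_action) 1%:M) 1.
    exists 1%:M; last by rewrite /f mxE eqxx.
    apply: connected_component_refl; split=> [|k]; first exact: SO1.
    by rewrite weight_action_SO3//; have [] := @SO3_subgroup R.
  have fg : (f @` connected_component (fixed_points G weight_action) 1%:M) (g i i) by exists g.
  have [//|gN1] := weight_fixed_diag i2 (connected_component_sub cg).
  have /connected_intervalP/(_ _ _ fg f1 0) : connected _ := imC.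
  rewrite gN1 => -[|A /connected_component_sub/(weight_fixed_diag i2) + Ai0].
    by have := @ltr01 R; lra.
  rewrite -/(f A) Ai0; have := @ltr01 R; lra.
by apply/SO3_in_SO5P; split=> //; exact: gii.
Qed.

(** Conjugation by the quarter turn of the plane (0, j) moves the entry (j, j) to (0, 0), where
    elements of [H] have 1. An orthogonal matrix whose diagonal entries are all 1 is the
    identity. *)
Lemma SO3_normal_core N : normal_subgroup G N -> N `<=` H -> N = [set 1%:M].
Proof.
move=> [[N1 _ _] NG NJ] NH; rewrite eqEsubset; split=> [A NA|_ ->//].
have [oA _] := NG _ NA.
have diag j : A j j = 1.
  have [->|j0] := eqVneq j i0; first by have /SO3_in_SO5P[] := NH _ NA.
  have j0' : i0 != j by rewrite eq_sym.
  have r0 k : rotation i0 j (pi / 2) i0 k = (k == j)%:R :> R.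
    rewrite rotationE// eqxx (negbTE j0')/= cos_pihalf sin_pihalf eq_sym.
    have [<-|_] := eqVneq i0 k; first by rewrite (negbTE j0').
    by case: (k == j).
  have Gr : G (rotation i0 j (pi / 2)) by exact: rotation_SO.
  have /SO3_in_SO5P[_ + _] := NH _ (NJ _ _ Gr NA).
  rewrite (SO_inv Gr) mxE (bigD1 j)//= big1 => [|k kj]; last first.
    by rewrite [X in _ * X]mxE r0 (negbTE kj) mulr0.
  rewrite addr0 !mxE (bigD1 j)//= big1 => [|k kj]; last first.
    by rewrite r0 (negbTE kj) mul0r.
  by rewrite r0 eqxx mulr1 addr0 mul1r.
by apply/matrixP => i j; rewrite (orthogonal_row_eq oA (diag i)) mxE.
Qed.

Lemma SO5_gamma_symmetric : gamma_symmetric G H weight_action.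
Proof.
split.
- by split; [exact: SO_linear_lie_group|exact: SO_connected].
- exact: SO3_closed_subgroup.
- exact: weight_action_faithful.
- split=> [|h Hh]; first exact: weight_fixed_component.
  by split; [exact: SO3_sub|exact: weight_action_SO3].
- exact: SO3_normal_core.
Qed.

(** * Weight spaces and the graded components of so(5) *)

Definition weight_space a : set M :=
  [set X | X^T = - X /\ forall i j, deg i + deg j != a -> X i j = 0].

Lemma skew_entries (X : M) : X^T = - X -> forall i j, X j i = - X i j.
Proof. by move=> /matrixP h i j; have := h i j; rewrite !mxE. Qed.

Lemma so5_mx_skew (a1 b1 b2 b3 c1 c2 c3 x1 x2 x3 : R) :
  (so5_mx a1 b1 b2 b3 c1 c2 c3 x1 x2 x3)^T = - so5_mx a1 b1 b2 b3 c1 c2 c3 x1 x2 x3.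
Proof.
by apply/matrixP => i j; rewrite !mxE; elim/ord5P: i; elim/ord5P: j;
  rewrite /= ?oppr0 ?opprK.
Qed.

Lemma skew_so5_mx (X : M) : X^T = - X ->
  X = so5_mx (X i0 i1) (X i0 i2) (X i0 i3) (X i0 i4) (X i1 i2) (X i1 i3) (X i1 i4)
             (X i2 i3) (X i2 i4) (X i3 i4).
Proof.
move=> skX; have h := skew_entries skX.
have d i : X i i = 0 by have /eqP := h i i; rewrite -addr_eq0 -mulr2n mulrn_eq0 => /eqP.
apply/matrixP => i j; rewrite mxE; elim/ord5P: i; elim/ord5P: j; rewrite /= ?d //; exact: h.
Qed.

Lemma so5_componentE a : @so5_component R a = weight_space a.
Proof.
elim/GammaP: a; rewrite eqEsubset; split=> X.
- move=> [x1 [x2 [x3 ->]]]; split; first exact: so5_mx_skew.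
  by move=> i j; rewrite mxE; elim/ord5P: i; elim/ord5P: j; rewrite /= ?oppr0.
- move=> [skX z]; exists (X i2 i3), (X i2 i4), (X i3 i4).
  rewrite {1}(skew_so5_mx skX) (z i0 i1)// (z i0 i2)// (z i0 i3)// (z i0 i4)//.
  by rewrite (z i1 i2)// (z i1 i3)// (z i1 i4).
- move=> [a1 ->]; split; first exact: so5_mx_skew.
  by move=> i j; rewrite mxE; elim/ord5P: i; elim/ord5P: j; rewrite /= ?oppr0.
- move=> [skX z]; exists (X i0 i1).
  rewrite {1}(skew_so5_mx skX) (z i0 i2)// (z i0 i3)// (z i0 i4)// (z i1 i2)//.
  by rewrite (z i1 i3)// (z i1 i4)// (z i2 i3)// (z i2 i4)// (z i3 i4).
- move=> [b1 [b2 [b3 ->]]]; split; first exact: so5_mx_skew.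
  by move=> i j; rewrite mxE; elim/ord5P: i; elim/ord5P: j; rewrite /= ?oppr0.
- move=> [skX z]; exists (X i0 i2), (X i0 i3), (X i0 i4).
  rewrite {1}(skew_so5_mx skX) (z i0 i1)// (z i1 i2)// (z i1 i3)// (z i1 i4)//.
  by rewrite (z i2 i3)// (z i2 i4)// (z i3 i4).
- move=> [c1 [c2 [c3 ->]]]; split; first exact: so5_mx_skew.
  by move=> i j; rewrite mxE; elim/ord5P: i; elim/ord5P: j; rewrite /= ?oppr0.
move=> [skX z]; exists (X i1 i2), (X i1 i3), (X i1 i4).
rewrite {1}(skew_so5_mx skX) (z i0 i1)// (z i0 i2)// (z i0 i3)// (z i0 i4)//.
by rewrite (z i2 i3)// (z i2 i4)// (z i3 i4).
Qed.

(** A nonzero entry (i, j) of an eigenvector forces [chi (deg i + deg j) = chi a], and characters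
    separate weights. *)
Lemma weight_spaceP a X : weight_space a X <->
  X^T = - X /\ forall k, weight_action k X = chi a k *: X.
Proof.
split=> -[skX h]; split=> //.
  move=> k; apply/matrixP => i j; rewrite weight_actionE mxE.
  by have [->//|/h->] := eqVneq (deg i + deg j) a; rewrite !mulr0.
move=> i j dij; apply: contra_neq_eq dij => Xij; apply: chi_sep => k.
have /matrixP/(_ i j) := h k; rewrite weight_actionE mxE => /eqP.
by rewrite -subr_eq0 -mulrBl mulf_eq0 (negbTE Xij) orbF subr_eq0 => /eqP.
Qed.

(** The action is linear on matrices, so it is its own tangent map. *)
Lemma eigenspaceE a :
  simultaneous_eigenspace G weight_action (chi a) = weight_space a.
Proof.
have dw k c X : is_derive (0 : R) (1 : R) c X ->
    is_derive (0 : R) (1 : R) (weight_action k \o c) (weight_action k X).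
  by move=> dc; exact: (is_derive_mulmxr _ (is_derive_mulmxl _ dc)).
rewrite eqEsubset; split=> X.
  move=> [tX hX]; apply/weight_spaceP; split=> [|k]; first exact/tangent_SO1.
  have [c cX] := tX; apply: is_derive_unique (hX k c cX); apply: dw.
  by case: cX.
move=> /weight_spaceP[skX hX]; split; first exact/tangent_SO1.
by move=> k c [_ _ dc]; rewrite -hX; exact: dw.
Qed.

(** Distinct indices with [deg i + deg j = 0] are among the last three, whose rotations lie in [H].
    Conversely, entries of nonzero weight are constant along curves in [H]. *)
Lemma weight_space0 : weight_space 0 = tangent H 1%:M.
Proof.
rewrite eqEsubset; split=> X.
  move=> [skX hX]; apply: skew_tangent1 => //; first exact: SO3_subgroup.
  move=> i j Xij.
  have ij : i != j.
    apply: contraNneq Xij => ->; have := skew_entries skX j j.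
    by move=> /eqP; rewrite -addr_eq0 -mulr2n mulrn_eq0.
  have dij : deg i + deg j = 0 by apply: contraNeq Xij => /hX ->.
  exists (rotation i j); split; [|exact: rotation0|exact: rotation_derive0].
  move=> t; apply: SO3_rotation => //.
    by move/eqP: dij ij; clear; elim/ord5P: i; elim/ord5P: j.
  by move/eqP: dij ij; clear; elim/ord5P: i; elim/ord5P: j.
move=> [c [cH c0 dc]]; split.
  apply/tangent_SO1; exists c; split=> // t; exact: SO3_sub.
move=> i j dij; have cij : (fun t => c t i j) = cst (i == j)%:R.
  apply/funext => t; have [r0 r1 c0' c1] := SO3_entries (cH t).
  by move: dij; elim/ord5P: i; elim/ord5P: j; rewrite ?(r0, r1, c0', c1).
have := (is_derive_mxP _ _ _).1 dc i j; rewrite cij => -[_ <-].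
exact: derive_cst.
Qed.

Lemma SO5_gamma_grading : gamma_grading G H weight_action (@so5_component R).
Proof.
split.
- exists chi; split; [exact: chiDr|exact: chiDl| |exact: chi0|].
    by move=> a b ab; apply: chi_sep => k; rewrite ab.
  by move=> a; rewrite so5_componentE eigenspaceE.
- move=> X /tangent_SO1 skX.
  (* The projection to degree [a] keeps the entries of weight [a]; each position has a single
     weight, hence uniqueness. *)
  exists [ffun a => \matrix_(i, j) (if deg i + deg j == a then X i j else 0)].
  split; first split.
  + move=> a; rewrite so5_componentE ffunE; split.
      apply/matrixP => i j; rewrite !mxE [deg j + _]addrC (skew_entries skX i j).
      by case: ifP; rewrite ?oppr0.
    by move=> i j dij; rewrite mxE (negbTE dij).
  + apply/matrixP => i j; rewrite summxE (bigD1 (deg i + deg j))//= ffunE mxE eqxx.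
    rewrite big1 ?addr0// => a; rewrite ffunE mxE eq_sym => /negbTE -> //.
  move=> f [fgr ->]; apply/ffunP => a; rewrite ffunE; apply/matrixP => i j.
  have z b : deg i + deg j != b -> f b i j = 0.
    by have := fgr b; rewrite so5_componentE => -[_]; exact.
  rewrite mxE; case: eqP => [<-|/eqP/z //]; rewrite summxE (bigD1 (deg i + deg j))//=.
  by rewrite big1 ?addr0// => b; rewrite eq_sym => /z.
- move=> a b X Y; rewrite !so5_componentE => /weight_spaceP[skX hX] /weight_spaceP[skY hY].
  apply/weight_spaceP; split=> [|k].
    by rewrite linearB/= !trmx_mul skX skY !mulNmx !mulmxN !opprK opprB.
  have -> : weight_action k (X *m Y - Y *m X) =
      weight_action k (X *m Y) - weight_action k (Y *m X).
    by rewrite /weight_action mulmxBr mulmxBl.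
  rewrite !weight_actionM !hX !hY chiDl -!scalemxAl -!scalemxAr !scalerA scalerBr.
  by rewrite [chi b k * _]mulrC.
by rewrite so5_componentE weight_space0.
Qed.

End Grading.

(** * The invariant metric *)

Section Metric.
Context {R : realType}.
Local Notation M := 'M[R]_5.
Local Notation G := (SO R 5).
Local Notation H := (@SO3_in_SO5 R).

Lemma curve_through_mulmx (A : M) (K L : set M) g (c : R -> M) X :
  (forall h, K h -> L (A *m h)) ->
  curve_through K g c X -> curve_through L (A *m g) (fun t => A *m c t) (A *m X).
Proof.
move=> KL [cK c0 dc]; split=> [t||]; [exact: KL|by rewrite c0|].
exact: is_derive_mulmxl.
Qed.

(** Left translation by [g^T], the inverse of [g], reduces to the tangent space at 1. *)
Lemma tangent_SO g X : G g -> tangent G g X <-> (g^T *m X)^T = - (g^T *m X).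
Proof.
move=> Gg; rewrite -tangent_SO1; split=> -[c cX].
  exists (fun t => g^T *m c t); rewrite -(SO_trmul Gg).
  by apply: (curve_through_mulmx _ cX) => h; apply: SO_mul; exact: SO_tr.
have [gg _] := Gg; exists (fun t => g *m c t).
have := @curve_through_mulmx g _ G _ _ _ _ cX; rewrite mulmx1 mulmxA gg mul1mx.
by apply=> h; exact: SO_mul.
Qed.

Lemma tangent_lcoset g X : G g ->
  tangent (lcoset_of H g) g X <-> weight_space 0 (g^T *m X).
Proof.
move=> Gg; rewrite weight_space0; split=> -[c cX].
  exists (fun t => g^T *m c t); rewrite -(SO_trmul Gg).
  apply: (curve_through_mulmx _ cX) => _ [h Hh <-].
  by rewrite mulmxA (SO_trmul Gg) mul1mx.
have [gg _] := Gg; exists (fun t => g *m c t).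
have := @curve_through_mulmx g _ (lcoset_of H g) _ _ _ _ cX.
by rewrite mulmx1 mulmxA gg mul1mx; apply=> h Hh; exists h.
Qed.

Definition lorentz_sign {d} (k : 'I_d.+1) : R := if k == ord0 then -1 else 1.

(* The entries above the diagonal indexed by the list p :: s serve as the
   coordinates of g^-1 u modulo the subspace W, the first one being timelike. *)
Lemma lorentz_signature_entries (p : 'I_5 * 'I_5) (s : seq ('I_5 * 'I_5)) g
    (V W : set M) (B : M -> M -> R) :
  let x k := nth p (p :: s) k in
  uniq (p :: s) -> all (fun ij : 'I_5 * 'I_5 => ij.1 < ij.2)%N (p :: s) ->
  G g ->
  (forall u, V u <-> (g^T *m u)^T = - (g^T *m u)) ->
  (forall u, W u <-> V u /\ forall k : 'I_(size s).+1, (g^T *m u) (x k).1 (x k).2 = 0) ->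
  (forall u v, V u -> V v -> B u v = \sum_(k < (size s).+1)
     lorentz_sign k * (g^T *m u) (x k).1 (x k).2 * (g^T *m v) (x k).1 (x k).2) ->
  lorentz_signature V W B.
Proof.
move=> x us /allP ls Gg VE WE BE.
have [gg _] := Gg; have ggT := SO_trmul Gg.
pose e (k : 'I_(size s).+1) : M := skew_delta (x k).1 (x k).2.
have xlt (k : 'I_(size s).+1) : ((x k).1 < (x k).2)%N by apply: ls; exact: mem_nth.
have skew_e k : (e k)^T = - e k by rewrite /e /skew_delta linearB/= !trmx_delta opprB.
have eE (k l : 'I_(size s).+1) : e k (x l).1 (x l).2 = (k == l)%:R.
  rewrite !mxE; have [<-|kl] := eqVneq k l.
    rewrite !eqxx/= (_ : (_ == _) = false) ?subr0//.
    by apply/negbTE; have := xlt k; rewrite -val_eqE/=; case: ltngtP.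
  have xkl : x k != x l by rewrite nth_uniq.
  have -> : ((x l).1 == (x k).1) && ((x l).2 == (x k).2) = false.
    by apply/negbTE; rewrite eq_sym -pair_eqE in xkl *.
  (* The transpose of a listed position lies below the diagonal, so it is not listed. *)
  rewrite (_ : _ && _ = false) ?subr0//; apply/negbTE/negP => /andP[/eqP e1 /eqP e2].
  by have := xlt k; have := xlt l; rewrite e1 e2; case: ltngtP.
have VgX X : X^T = - X -> V (g *m X) by move=> skX; apply/VE; rewrite mulmxA ggT mul1mx.
have VD u v k : V u -> V v -> V (u - k *: v).
  move=> /VE hu /VE hv; apply/VE; rewrite mulmxBr -scalemxAr linearB linearZ/= hu hv.
  by rewrite scalerN opprB opprK addrC.
exists (size s), (fun k => g *m e k); split.
- by move=> k; exact: VgX.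
- move=> u Vu.
  have Vu' (c : 'rV[R]_(size s).+1) : V (u - \sum_i c 0 i *: (g *m e i)).
    have V0 : V 0 by rewrite -(mulmx0 5 g); apply: VgX; rewrite linear0 oppr0.
    rewrite -[X in _ - X]scale1r; apply: (VD) => //.
    apply: big_ind => [//|y z hy hz|k _].
      have -> : y + z = y - (-1) *: z by rewrite scaleN1r opprK.
      exact: (VD).
    have -> : c 0 k *: (g *m e k) = 0 - (- c 0 k) *: (g *m e k).
      by rewrite scaleNr opprK add0r.
    by apply: (VD) => //; exact: VgX.
  have cE (c : 'rV[R]_(size s).+1) (k : 'I_(size s).+1) :
      (g^T *m (u - \sum_i c 0 i *: (g *m e i))) (x k).1 (x k).2 =
      (g^T *m u) (x k).1 (x k).2 - c 0 k.
    rewrite mulmxBr mulmx_sumr [LHS]mxE [X in _ + X]mxE summxE; congr (_ - _).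
    rewrite (bigD1 k)//= -scalemxAr mulmxA ggT mul1mx mxE eE eqxx mulr1 big1 ?addr0//.
    by move=> i ik; rewrite -scalemxAr mulmxA ggT mul1mx mxE eE (negbTE ik) mulr0.
  exists (\row_k (g^T *m u) (x k).1 (x k).2); split.
    by apply/WE; split=> // k; rewrite cE [X in _ - X]mxE subrr.
  move=> c /WE[_ hc]; apply/rowP => k; have := hc k.
  by rewrite cE => /eqP; rewrite subr_eq0 => /eqP <-; rewrite mxE.
move=> i j; rewrite BE; [|exact: VgX|exact: VgX].
rewrite mulmxA ggT mul1mx mulmxA ggT mul1mx (bigD1 i)//= eE eqxx mulr1 big1 ?addr0.
  by rewrite eE [j == i]eq_sym; case: (i == j); rewrite ?mulr1 ?mulr0.
by move=> k ki; rewrite eE eq_sym (negbTE ki) mulr0 mul0r.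
Qed.

(** * The form q on so(5) and the left-invariant metric *)

Lemma so5_tangent1 (u : M) :
  tangent G 1%:M u <-> ((1%:M : M)^T *m u)^T = - ((1%:M : M)^T *m u).
Proof. by rewrite trmx1 mul1mx; exact: tangent_SO1. Qed.

Definition so5_entries : seq ('I_5 * 'I_5) :=
  [:: (i2, i3); (i2, i4); (i3, i4); (i0, i2); (i0, i3); (i0, i4); (i1, i2); (i1, i3); (i1, i4)].

Definition m_entries : seq ('I_5 * 'I_5) :=
  [:: (i0, i2); (i0, i3); (i0, i4); (i1, i2); (i1, i3); (i1, i4)].

Lemma q5E (X Y : M) : q5 X Y =
  - (X i0 i1 * Y i0 i1) + X i2 i3 * Y i2 i3 + X i2 i4 * Y i2 i4 + X i3 i4 * Y i3 i4
  + X i0 i2 * Y i0 i2 + X i0 i3 * Y i0 i3 + X i0 i4 * Y i0 i4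
  + X i1 i2 * Y i1 i2 + X i1 i3 * Y i1 i3 + X i1 i4 * Y i1 i4.
Proof.
have e0 : inord 0 = i0 by apply: val_inj; rewrite /= inordK.
have e1 : inord 1 = i1 by apply: val_inj; rewrite /= inordK.
have e2 : inord 2 = i2 by apply: val_inj; rewrite /= inordK.
have e3 : inord 3 = i3 by apply: val_inj; rewrite /= inordK.
have e4 : inord 4 = i4 by apply: val_inj; rewrite /= inordK.
rewrite /q5 /omega1 /omega2 /omega3 /alpha1 /beta1 /beta2 /beta3 /gamma1 /gamma2 /gamma3.
by rewrite e0 e1 e2 e3 e4; ring.
Qed.

Lemma q5_bilinear : symmetric_bilinear_on (tangent G 1%:M) (@q5 R).
Proof.
by split=> [u v _ _|k u v w _ _ _]; rewrite !q5E ?mxE; ring.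
Qed.

(** The timelike position (0, 1) heads the list of the ten positions above the diagonal. They
    determine a skew matrix, so the subspace divided out is 0. *)
Lemma q5_lorentz : lorentz_signature (tangent G 1%:M) [set 0] (@q5 R).
Proof.
apply: (@lorentz_signature_entries (i0, i1) so5_entries 1%:M) => //.
- exact: SO1.
- exact: so5_tangent1.
- move=> u; rewrite trmx1 mul1mx tangent_SO1; split=> [->|[sku hu]].
    by split=> [|k]; rewrite ?linear0 ?oppr0 ?mxE.
  have h := hu (inord _); rewrite /= (skew_so5_mx sku).
  have h0 := h 0%N; have h1 := h 1%N; have h2 := h 2%N; have h3 := h 3%N; have h4 := h 4%N.
  have h5 := h 5%N; have h6 := h 6%N; have h7 := h 7%N; have h8 := h 8%N; have h9 := h 9%N.
  move: h0 h1 h2 h3 h4 h5 h6 h7 h8 h9; rewrite !inordK//= => -> -> -> -> -> -> -> -> -> ->.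
  by apply/matrixP => i j; rewrite !mxE; elim/ord5P: i; elim/ord5P: j; rewrite /= ?oppr0.
- move=> u v _ _; rewrite trmx1 !mul1mx q5E.
  by rewrite !big_ord_recl big_ord0 /lorentz_sign /=; ring.
Qed.

(* On so(5) this is q with the omega_i^2 removed, written so that its invariance
   under conjugation by SO(3) is visible. *)
Definition qm (X Y : M) : R :=
  (X *m Y^T) i0 i0 + (X *m Y^T) i1 i1 - 3 * (X i0 i1 * Y i0 i1).

(** The two diagonal entries of [X Y^T] are scalar products of rows. The product of the (0, 1)
    entries occurs in both, and subtracting it three times leaves the coefficient -1. *)
Lemma qmE X Y : X^T = - X -> Y^T = - Y -> qm X Y =
  - (X i0 i1 * Y i0 i1) + X i0 i2 * Y i0 i2 + X i0 i3 * Y i0 i3 + X i0 i4 * Y i0 i4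
  + X i1 i2 * Y i1 i2 + X i1 i3 * Y i1 i3 + X i1 i4 * Y i1 i4.
Proof.
move=> /skew_entries hX /skew_entries hY; rewrite /qm !mxE !sum5 !mxE.
have d Z : (forall i j : 'I_5, Z j i = - Z i j) -> forall i, Z i i = 0 :> R.
  by move=> h i; have /eqP := h i i; rewrite -addr_eq0 -mulr2n mulrn_eq0 => /eqP.
by rewrite !(d X hX) !(d Y hY) (hX i0 i1) (hY i0 i1); ring.
Qed.

Lemma qmC X Y : qm X Y = qm Y X.
Proof.
have trE (Z T : M) i : (Z *m T^T : M) i i = (T *m Z^T) i i.
  by rewrite -[in LHS](trmxK (Z *m T^T)) mxE trmx_mul trmxK.
by rewrite /qm !(trE X Y) [X i0 i1 * _]mulrC.
Qed.

Lemma qmDl k X Y Z : qm (k *: X + Y) Z = k * qm X Z + qm Y Z.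
Proof.
rewrite /qm mulmxDl -scalemxAl; move: (X *m Z^T) (Y *m Z^T) => A B.
by rewrite !mxE; ring.
Qed.

Lemma qm_weight0 X Y : weight_space 0 X -> qm X Y = 0.
Proof.
move=> [skX z]; rewrite /qm !mxE !sum5.
have d i : X i i = 0.
  by have /eqP := skew_entries skX i i; rewrite -addr_eq0 -mulr2n mulrn_eq0 => /eqP.
rewrite !d !(z i0 i1, z i0 i2, z i0 i3, z i0 i4) //.
rewrite !(z i1 i0, z i1 i2, z i1 i3, z i1 i4) //.
by rewrite !mul0r !addr0 mulr0 subr0.
Qed.

(** [X Y^T] is conjugated along with [X] and [Y] because [h h^T = 1], and conjugation by [h] leaves
    the upper left 2 x 2 block unchanged. *)
Lemma qm_conj h X Y : H h -> qm (h^T *m X *m h) (h^T *m Y *m h) = qm X Y.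
Proof.
move=> Hh; have [r0 r1 c0 c1] := SO3_entries Hh; have [hh _] := SO3_sub Hh.
have E Z (i j : 'I_5) : (i < 2)%N -> (j < 2)%N -> (h^T *m Z *m h) i j = Z i j.
  move=> i2 j2; rewrite mxE sum5 !mxE !sum5 !mxE.
  move: i2 j2; elim/ord5P: i => // _; elim/ord5P: j => // _;
    by rewrite !(c0, c1)/= !(mul1r, mul0r, mulr1, mulr0, addr0, add0r).
rewrite /qm; have -> : h^T *m X *m h *m (h^T *m Y *m h)^T = h^T *m (X *m Y^T) *m h.
  rewrite !trmx_mul trmxK -!mulmxA (mulmxA h h^T) hh mul1mx.
  by rewrite !mulmxA.
by rewrite !E.
Qed.

Definition gm (g u v : M) : R := qm (g^T *m u) (g^T *m v).

Lemma gm_invariant : invariant_lorentz_metric G H gm.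
Proof.
split.
- move=> g _; split=> [u v _ _|k u v w _ _ _]; first exact: qmC.
  by rewrite /gm mulmxDr -scalemxAr qmDl.
(* On the left-invariant frame the tensor is constant. *)
- move=> X Y _ _ g Gg; exists setT, (fun=> qm X Y : R^o); split=> //.
  + exact: openT.
  + by move=> k; exact: class_C_cst.
  + by move=> h _ Gh; rewrite /gm !mulmxA (SO_trmul Gh) !mul1mx.
- split=> [g u v Gg /(tangent_lcoset _ Gg) h _|g h u v Gg Hh _ _].
    exact: qm_weight0.
  (* Moved back to the identity, right translation by [h] becomes conjugation. *)
  have e w : (g *m h)^T *m (w *m h) = h^T *m (g^T *m w) *m h by rewrite trmx_mul !mulmxA.
  by rewrite /gm !e qm_conj.
- move=> g Gg.
  apply: (@lorentz_signature_entries (i0, i1) m_entries g) => //.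
  + by move=> u; exact: tangent_SO.
  (* The seven positions listed are those of nonzero weight above the diagonal. *)
  + move=> u; rewrite tangent_lcoset// (tangent_SO _ Gg).
    move: (g^T *m u) => X; split=> [[skX z]|[skX hX]].
      split=> // k; apply: z; case: k => -[|[|[|[|[|[|[|//]]]]]]] //.
    split=> // i j; have h := hX (inord _); rewrite /= in h; rewrite (skew_so5_mx skX).
    have h0 := h 0%N; have h1 := h 1%N; have h2 := h 2%N; have h3 := h 3%N; have h4 := h 4%N.
    have h5 := h 5%N; have h6 := h 6%N.
    move: h0 h1 h2 h3 h4 h5 h6; rewrite !inordK//= => -> -> -> -> -> -> ->.
    by rewrite mxE; elim/ord5P: i; elim/ord5P: j; rewrite /= ?oppr0.
  + move=> u v /(tangent_SO _ Gg) sku /(tangent_SO _ Gg) skv.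
    by rewrite /gm qmE// !big_ord_recl big_ord0 /lorentz_sign /=; ring.
- move=> k g u v Gk Gg _ _.
  by rewrite /gm trmx_mul -!mulmxA !(mulmxA k^T) (SO_trmul Gk) !mul1mx.
Qed.

(** Components of different weights have disjoint supports. *)
Lemma gm_orthogonal a b X Y : a != 0 -> b != 0 -> a != b ->
  so5_component a X -> so5_component b Y -> gm 1%:M X Y = 0.
Proof.
move=> _ _ ab; rewrite !so5_componentE => -[skX zX] [skY zY].
have XY i j : X i j * Y i j = 0.
  have [e|/zX->] := eqVneq (deg i + deg j) a; last by rewrite mul0r.
  by rewrite zY ?mulr0// e.
by rewrite /gm trmx1 !mul1mx qmE// !XY oppr0 !addr0.
Qed.

(** Elements of m have no entry of weight 0, so the [omega] terms of [q5] vanish on them. *)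
Lemma gm_q5 X Y : complement_m (@so5_component R) X ->
  complement_m (@so5_component R) Y -> gm 1%:M X Y = q5 X Y.
Proof.
have mP Z : complement_m (@so5_component R) Z ->
    Z^T = - Z /\ forall i j, deg i + deg j == 0 -> Z i j = 0.
  move=> [f [fgr ->]]; split.
    rewrite linear_sum/= -sumrN; apply: eq_bigr => a /fgr.
    by rewrite so5_componentE => -[].
  move=> i j /eqP dij; rewrite summxE big1// => a a0; have := fgr _ a0.
  by rewrite so5_componentE => -[_]; apply; rewrite dij eq_sym.
move=> /mP[skX zX] /mP[skY zY]; rewrite /gm trmx1 !mul1mx qmE// q5E.
by rewrite (zX i2 i3)// (zX i2 i4)// (zX i3 i4)//; ring.
Qed.

End Metric.

Theorem proposition13 (R : realType) :
  (* q is a Lorentzian inner product on so(5) *)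
  (symmetric_bilinear_on (tangent (SO R 5) 1%:M) (@q5 R) /\
   lorentz_signature (tangent (SO R 5) 1%:M) [set 0] (@q5 R)) /\
  (* SO(5)/SO(3) is not symmetric *)
  ~ (exists rho : 'Z_2 -> 'M[R]_5 -> 'M[R]_5,
       gamma_symmetric (SO R 5) (@SO3_in_SO5 R) rho) /\
  (* the induced Lorentzian (Z_2 x Z_2)-symmetric structure *)
  exists (rho : ('Z_2 * 'Z_2)%type -> 'M[R]_5 -> 'M[R]_5)
         (gm : 'M[R]_5 -> 'M[R]_5 -> 'M[R]_5 -> R),
    lorentzian_gamma_symmetric (SO R 5) (@SO3_in_SO5 R) rho
      (@so5_component R) gm /\
    forall X Y, complement_m (@so5_component R) X ->
                complement_m (@so5_component R) Y -> gm 1%:M X Y = q5 X Y.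
Proof.
split; first by split; [exact: q5_bilinear|exact: q5_lorentz].
split; first exact: SO3_not_symmetric.
exists (@weight_action R), (@gm R); split; last exact: gm_q5.
split; [exact: SO5_gamma_symmetric|exact: SO5_gamma_grading|exact: gm_invariant|].
exact: gm_orthogonal.
Qed.
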